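(* Let $G$ be a connected unicyclic graph on $n\geq6$ vertices. Then $\partial^Q_1(G)\leq\partial^Q_1(Ki_{n,3})$, with equality if and only if $G\cong Ki_{n,3}$.
   Context: All graphs are finite, simple, undirected and connected; a unicyclic graph is a connected graph with exactly one cycle. $d(u,v)$ is graph distance, $Tr(v)=\sum_u d(v,u)$ the transmission, $Tr(G)$ the diagonal matrix of transmissions, $D(G)$ the distance matrix, and $\mathcal{Q}(G)=Tr(G)+D(G)$ the distance signless Laplacian matrix with largest eigenvalue $\partial^Q_1(G)$. The kite $Ki_{n,3}$ is the $n$-vertex unicyclic graph obtained from a triangle $C_3$ and a path $P_{n-3}$ by adding an edge between an end-vertex of the path and a vertex of the triangle. *)

(* Defs.v *)
From HB Require Import structures.
From mathcomp Require Import all_boot all_order all_algebra.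
From mathcomp Require Import classical_sets reals.

Set Implicit Arguments.
Unset Strict Implicit.
Unset Printing Implicit Defensive.

Import Order.TTheory GRing.Theory Num.Theory.

Local Open Scope ring_scope.

(* A graph is given by its adjacency relation [e] on a finite vertex type. *)
Definition simple_graph (T : finType) (e : rel T) : Prop :=
  symmetric e /\ irreflexive e.

Definition connected_graph (T : finType) (e : rel T) : Prop :=
  forall u v : T, connect e u v.

(* A cycle is a subgraph without isolated vertices, so it is represented by its
   edge set: the vertex sequences that differ by a rotation or a reversal
   describe the same cycle. *)
Definition cycle_edges (T : finType) (s : seq T) : {set {set T}} :=
  [set [set x; next s x] | x in s].

Definition is_graph_cycle (T : finType) (e : rel T) (C : {set {set T}}) : Prop :=
  exists s : seq T, [/\ (2 < size s)%N, ucycle e s & C = cycle_edges s].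

Definition unicyclic (T : finType) (e : rel T) : Prop :=
  connected_graph e /\ exists! C : {set {set T}}, is_graph_cycle e C.

Definition graph_iso (T U : finType) (e : rel T) (f : rel U) : Prop :=
  exists2 h : T -> U, bijective h & forall x y : T, e x y = f (h x) (h y).

(* [find] returns the least [k < #|T|] such that a walk with [k] edges joins
   [u] to [v], and the junk value [#|T|] when [u] and [v] are not connected. *)
Definition gdist (T : finType) (e : rel T) (u v : T) : nat :=
  find (fun k => [exists p : k.-tuple T, path e u p && (last u p == v)])
       (iota 0 #|T|).

Definition transmission (T : finType) (e : rel T) (v : T) : nat :=
  (\sum_(u : T) gdist e v u)%N.

Definition distance_mx (R : realType) (T : finType) (e : rel T) :
    'M[R]_#|T| :=
  \matrix_(i, j) (gdist e (enum_val i) (enum_val j))%:R.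

Definition transmission_mx (R : realType) (T : finType) (e : rel T) :
    'M[R]_#|T| :=
  diag_mx (\row_i (transmission e (enum_val i))%:R).

Definition dist_signless_laplacian (R : realType) (T : finType) (e : rel T) :
    'M[R]_#|T| :=
  transmission_mx R e + distance_mx R e.

(* The supremum is a maximum when there is an eigenvalue, in particular for a
   symmetric matrix of positive size. *)
Definition largest_eigenvalue (R : realType) (m : nat) (A : 'M[R]_m) : R :=
  sup [set a : R | eigenvalue A a]%classic.

Definition dQ1 (R : realType) (T : finType) (e : rel T) : R :=
  largest_eigenvalue (dist_signless_laplacian R e).

(* Ki_{n,3} for n >= 4: triangle on 0, 1, 2; path 3, 4, ..., n - 1;
   and the edge {2, 3}. *)
Definition kite3_arc (i j : nat) : bool :=
  [|| (i < j < 3)%N, (3 <= i)%N && (j == i.+1)%N | (i == 2)%N && (j == 3)%N].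

Definition kite3 (n : nat) : rel 'I_n :=
  fun i j => kite3_arc i j || kite3_arc j i.

(* Main.v *)
Require Import Defs.
From mathcomp Require Import all_boot all_order all_algebra.
From mathcomp Require Import all_classical reals.
From mathcomp Require Import topology normedtype derive realfun.
From mathcomp Require Import zify ring lra.

(* For a connected graph the quadratic form of the distance signless Laplacian
   is half of the sum of d(u,v) (x_u + x_v)^2 over ordered pairs. Fix a positive
   maximiser x of the Rayleigh quotient of G: it is enough to show that, with x
   fixed, the distances of G can be replaced by those of a kite on the same
   vertices without decreasing this sum, and strictly increasing it unless
   nothing changes. Each step below compares a distance function with a weighted
   average of others, one of which must then have a larger sum.
   - If a connected piece of the graph hangs on a path, or on an edge of a path,
     sliding it along the path is a convex motion, so one of the two ends is at
     least as good. This turns the trees hanging on the cycle into paths, merges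
     the paths of adjacent cycle vertices, and settles the cycle lengths 3 and,
     with one more averaging of two kites, 4.
   - A cycle of length g >= 5 is cut open at some place, and a triangle is
     created at one end. Averaging over all the places and both directions
     increases all the distances if g is odd. If g is even only the opposite
     pairs lose; the average then omits the heaviest opposite pair, and the loss
     is compensated by a Ptolemy-type inequality between weights of blocks. *)

(** The entries of [x] are unknown, so no single transformation of the graph can be shown to be an
    improvement. Averaging avoids comparing entries; the few comparisons that remain are settled by
    a symmetry or by choosing a maximum. The intermediate functions on pairs of vertices need not be
    distances of a graph. They may be enlarged freely, since the weights (x_u + x_v)^2 are positive,
    and only the last one is compared with the distances of the actual kite. Equality is tracked by
    [dominated]: a step either strictly increases the sum or keeps the function. If no step is
    strict, G has the distances of a kite, and adjacency is distance one. Length four is separate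
    because the scheme for even cycles breaks there: an adjacent pair with one end in the omitted
    pair of blocks gains 1 instead of the 2 required. The substitute, an average of two kites, is
    the place where n >= 6 enters. *)

Set Implicit Arguments.
Unset Strict Implicit.
Unset Printing Implicit Defensive.
Import Order.TTheory GRing.Theory Num.Theory.
Import numFieldNormedType.Exports.

(** * Perron vectors of positive symmetric matrices *)

Section Perron.
Local Open Scope ring_scope.
Variables (R : realType) (n : nat) (A : 'M[R]_n).
Variable i0 : 'I_n.
Hypothesis A_sym : forall i j, A i j = A j i.
Hypothesis A_gt0 : forall i j, 0 < A i j.
Implicit Types (u v y : 'rV[R]_n).

Definition sqnorm y : R := \sum_i y ord0 i ^+ 2.
Definition qform y : R := \sum_i \sum_j A i j * (y ord0 i * y ord0 j).

Lemma sqnorm_ge0 y : 0 <= sqnorm y.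
Proof. by apply: sumr_ge0 => i _; rewrite sqr_ge0. Qed.

Lemma sqnorm_eq0 y : (sqnorm y == 0) = (y == 0).
Proof.
apply/idP/eqP => [|->]; last first.
  by rewrite /sqnorm big1 // => i _; rewrite mxE expr0n.
rewrite psumr_eq0 => [/allP y0|i _]; last exact: sqr_ge0.
apply/rowP => i; rewrite mxE; apply/eqP.
by have /implyP := y0 i (mem_index_enum i); rewrite sqrf_eq0; apply.
Qed.

Lemma sqnormZ a y : sqnorm (a *: y) = a ^+ 2 * sqnorm y.
Proof.
by rewrite /sqnorm mulr_sumr; apply: eq_bigr => i _; rewrite mxE exprMn.
Qed.

Lemma qformZ a y : qform (a *: y) = a ^+ 2 * qform y.
Proof.
rewrite /qform mulr_sumr; apply: eq_bigr => i _; rewrite mulr_sumr.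
by apply: eq_bigr => j _; rewrite !mxE; ring.
Qed.

Lemma qform_eigen y a : y *m A = a *: y -> qform y = a * sqnorm y.
Proof.
move=> /rowP eig; rewrite /qform exchange_big /sqnorm mulr_sumr.
apply: eq_bigr => j _ /=; have := eig j; rewrite !mxE => eigj.
transitivity ((\sum_i y ord0 i * A i j) * y ord0 j).
  by rewrite mulr_suml; apply: eq_bigr => i _; ring.
by rewrite eigj; ring.
Qed.

Lemma sqnorm_continuous : continuous sqnorm.
Proof.
apply: continuous_big => [|i _ y]; first exact: add_continuous.
apply: (@continuous_comp _ _ _ (fun M : 'rV[R]_n => M ord0 i) (fun a => a ^+ 2)).
  exact: coord_continuous.
exact: exprn_continuous.
Qed.

Lemma qform_continuous : continuous qform.
Proof.
apply: continuous_big => [|i _]; first exact: add_continuous.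
apply: (@continuous_big R 'I_n +%R 0 xpredT add_continuous _ _
  (fun j (y : 'rV[R]_n) => A i j * (y ord0 i * y ord0 j))) => j _ y.
apply: (@continuousM R _ (fun=> A i j) (fun z : 'rV[R]_n => z ord0 i * z ord0 j)).
  exact: cst_continuous.
by apply: continuousM; exact: coord_continuous.
Qed.

Lemma rayleigh_max : exists2 v, sqnorm v = 1 &
  forall y, qform y <= qform v * sqnorm y.
Proof.
pose S : set 'rV[R]_n := [set y | sqnorm y = 1]%classic.
have [||y1 Sy1|v vS v_max] := @EVT_max_rV R n qform S.
- exists (delta_mx ord0 i0); rewrite /S /= /sqnorm (bigD1 i0) //=.
  rewrite big1 => [|i ni0]; rewrite mxE ?eqxx ?expr1n ?addr0 //.
  by rewrite (negbTE ni0) andbF expr0n.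
- apply: bounded_closed_compact.
    exists 1; split; first exact: num_real.
    move=> M M1 y Sy; apply: le_trans (ltW M1).
    rewrite [leLHS]/Num.norm /= mx_normrE; apply/bigmax_leP; split=> // -[i j] _ /=.
    rewrite (ord1 i) -(@ler_pXn2r _ 2) ?nnegrE // expr1n real_normK ?num_real //.
    move: Sy; rewrite /S /= => <-; rewrite /sqnorm (bigD1 j) //= lerDl.
    by apply: sumr_ge0 => k _; rewrite sqr_ge0.
  rewrite (_ : S = sqnorm @^-1` [set 1])%classic //.
  by apply: preimage_closed; [move=> y _; exact: sqnorm_continuous|exact: closed_eq].
- exact/continuous_subspaceT/qform_continuous.
move: vS; rewrite inE /S /= => v1; exists v => // y.
have [->|y_neq0] := eqVneq y 0.
  by rewrite -[0](scale0r v) qformZ sqnormZ; lra.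
have sq_gt0 : 0 < sqnorm y by rewrite lt_def sqnorm_eq0 y_neq0 sqnorm_ge0.
have := v_max ((Num.sqrt (sqnorm y))^-1 *: y).
rewrite inE /S /= sqnormZ qformZ exprVn sqr_sqrtr ?sqnorm_ge0 //.
by rewrite mulVf ?gt_eqF // => /(_ erefl); rewrite mulrC ler_pdivrMr.
Qed.

(** Perturbing [v] along the basis vector [k] turns maximality into [2 t D <= t^2 K] for all real
    [t], where [D] is the [k]-th coordinate of [v A - a v]. This forces [D = 0]. *)
Lemma rayleigh_eigen v a : sqnorm v = 1 -> qform v = a ->
  (forall y, qform y <= a * sqnorm y) -> v *m A = a *: v.
Proof.
move=> v1 va v_max; apply/rowP => k.
set b := (v *m A) ord0 k; rewrite mxE; set c := v ord0 k.
have qE t : qform (v + t *: delta_mx ord0 k) = a + t * b *+ 2 + t ^+ 2 * A k k.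
  have dE (f : 'I_n -> R) :
      \sum_j f j * (delta_mx ord0 k : 'rV[R]_n) ord0 j = f k.
    rewrite (bigD1 k) //= big1 => [|j jk]; rewrite mxE ?eqxx ?mulr1 ?addr0 //.
    by rewrite (negbTE jk) andbF mulr0.
  have bE : b = \sum_i v ord0 i * A i k by rewrite /b mxE.
  have -> : qform (v + t *: delta_mx ord0 k) = qform v
    + t * (\sum_i \sum_j (A i j * v ord0 i) * (delta_mx ord0 k : 'rV_n) ord0 j)
    + t * (\sum_j \sum_i (A i j * v ord0 j) * (delta_mx ord0 k : 'rV_n) ord0 i)
    + t ^+ 2 * (\sum_i \sum_j (A i j * (delta_mx ord0 k : 'rV_n) ord0 i) * (delta_mx ord0 k : 'rV_n) ord0 j).
    rewrite [X in _ + t * X + _]exchange_big /= /qform !mulr_sumr -!big_split /=.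
    apply: eq_bigr => i _; rewrite !mulr_sumr -!big_split /=.
    by apply: eq_bigr => j _; rewrite !mxE; ring.
  rewrite va; under eq_bigr do rewrite dE.
  under [X in _ + t * X + _]eq_bigr do rewrite dE.
  under [X in _ + t ^+ 2 * X]eq_bigr do rewrite dE.
  rewrite dE.
  have -> : \sum_i A i k * v ord0 i = b.
    by rewrite bE; apply: eq_bigr => i _; rewrite mulrC.
  have -> : \sum_j A k j * v ord0 j = b.
    by rewrite bE; apply: eq_bigr => i _; rewrite mulrC A_sym.
  by ring.
have sE t : sqnorm (v + t *: delta_mx ord0 k) = 1 + t * c *+ 2 + t ^+ 2.
  rewrite /sqnorm -v1 /sqnorm (bigD1 k) //= [in RHS](bigD1 k) //= !mxE !eqxx.
  rewrite (eq_bigr (fun i => v ord0 i ^+ 2)) => [|i /negbTE ik].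
    by rewrite /c mulr1; ring.
  by rewrite !mxE ik andbF mulr0 addr0.
have lin t : t * (b - a * c) *+ 2 <= t ^+ 2 * (a - A k k).
  by have := v_max (v + t *: delta_mx ord0 k); rewrite qE sE; lra.
set D := b - a * c in lin; set K := a - A k k in lin.
suff : D = 0 by rewrite /D; lra.
have K_ge0 : 0 <= K by have := lin 1; have := lin (-1); lra.
have K1_gt0 : 0 < K + 1 by lra.
(* The optimal choice would be [D / K], but [K] may vanish. *)
have := lin (D / (K + 1)).
rewrite expr_div_n => le1; apply/eqP; rewrite -sqrf_eq0; apply/eqP.
have D2 := sqr_ge0 D.
have : D ^+ 2 * (K + 1) *+ 2 <= D ^+ 2 * K.
  have -> : D ^+ 2 * (K + 1) *+ 2 = (D / (K + 1) * D *+ 2) * (K + 1) ^+ 2.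
    by field; lra.
  have -> : D ^+ 2 * K = (D ^+ 2 / (K + 1) ^+ 2 * K) * (K + 1) ^+ 2.
    by field; lra.
  by rewrite ler_pM2r ?exprn_gt0.
nra.
Qed.

(** Absolute values do not decrease the form because the entries of [A] are positive, so a maximiser
    can be taken nonnegative. A zero coordinate of this eigenvector would be a vanishing sum of
    nonnegative terms [v_j A_ji], and then [v = 0]. *)
Lemma perron : exists2 v : 'rV[R]_n, (forall i, 0 < v ord0 i) &
  qform v = largest_eigenvalue A * sqnorm v /\
  forall y, qform y <= largest_eigenvalue A * sqnorm y.
Proof.
have [u u1 u_max] := rayleigh_max.
pose v : 'rV[R]_n := \row_i `|u ord0 i|.
have v1 : sqnorm v = 1.
  rewrite -u1; apply: eq_bigr => i _.
  by rewrite mxE real_normK ?num_real.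
have uv : qform u <= qform v.
  apply: ler_sum => i _; apply: ler_sum => j _; rewrite !mxE.
  by rewrite ler_wpM2l ?(ltW (A_gt0 _ _)) // -normrM ler_norm.
have vu : qform v = qform u.
  by apply/eqP; rewrite eq_le uv andbT -[leRHS]mulr1 -v1 u_max.
have eig : v *m A = qform u *: v by apply: rayleigh_eigen.
have v_neq0 : v != 0 by rewrite -sqnorm_eq0 v1 oner_eq0.
have lamE : largest_eigenvalue A = qform u.
  apply/eqP; rewrite eq_le /largest_eigenvalue; apply/andP; split.
    apply: ge_sup; first by exists (qform u); apply/eigenvalueP; exists v.
    move=> a /eigenvalueP[w wa w_neq0]; have := u_max w.
    rewrite (qform_eigen wa) ler_pM2r // lt_def sqnorm_eq0 w_neq0.
    exact: sqnorm_ge0.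
  apply: ub_le_sup; last by apply/eigenvalueP; exists v.
  exists (qform u) => a /eigenvalueP[w wa w_neq0]; have := u_max w.
  rewrite (qform_eigen wa) ler_pM2r // lt_def sqnorm_eq0 w_neq0.
  exact: sqnorm_ge0.
exists v; last by rewrite lamE v1 vu mulr1.
have v_ge0 i : 0 <= v ord0 i by rewrite mxE.
have [k vk] : exists k, 0 < v ord0 k.
  case: (boolP [exists k, 0 < v ord0 k]) => [/existsP //|].
  rewrite negb_exists => /forallP vn; case/negP: v_neq0; apply/eqP/rowP => i.
  by rewrite [RHS]mxE; apply/eqP; rewrite eq_le v_ge0 leNgt vn.
move=> i; rewrite lt_def v_ge0 andbT; apply: contraTneq vk => vi0.
have : \sum_j v ord0 j * A j i = qform u * v ord0 i.
  by have /rowP/(_ i) := eig; rewrite mxE [RHS]mxE.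
rewrite vi0 mulr0 => /eqP; rewrite psumr_eq0 => [|j _]; last first.
  by rewrite mulr_ge0 // ltW.
move=> /allP/(_ k (mem_index_enum k)) /=.
rewrite mulf_eq0 (gt_eqF (A_gt0 _ _)) orbF => /eqP ->.
by rewrite ltxx.
Qed.

End Perron.

(** * Weighted sums of distances *)

Definition adist (i j : nat) : nat := (i - j) + (j - i).

Section WeightedSum.
Variables (R : realFieldType) (T : finType) (x : T -> R).
Hypothesis x_gt0 : forall u, (0 < x u)%R.
Implicit Types D E : T -> T -> nat.

Definition wsum D : R := (\sum_u \sum_v (D u v)%:R * (x u + x v) ^+ 2)%R.

(** The second alternative is equality of the functions, not of their sums: composed along the whole
    proof, it yields the isomorphism in the equality case. *)
Definition dominated D D' := (wsum D < wsum D')%R \/ D =2 D'.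

Lemma wsum_ext D D' : D =2 D' -> wsum D = wsum D'.
Proof.
by move=> eqD; apply: eq_bigr => u _; apply: eq_bigr => v _; rewrite eqD.
Qed.

Lemma wt_gt0 u v : (0 < (x u + x v) ^+ 2)%R.
Proof. by rewrite exprn_gt0 // addr_gt0. Qed.

Lemma wsum_le D D' : (forall u v, D u v <= D' u v) -> (wsum D <= wsum D')%R.
Proof.
move=> leD; apply: ler_sum => u _; apply: ler_sum => v _.
by rewrite ler_wpM2r ?ler_nat // ltW ?wt_gt0.
Qed.

Lemma wsum_lt D D' u v : (forall u v, D u v <= D' u v) -> D u v < D' u v ->
  (wsum D < wsum D')%R.
Proof.
move=> leD ltD; rewrite /wsum (bigD1 u) //= [ltRHS](bigD1 u) //=.
apply: ltr_leD; last first.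
  apply: ler_sum => a _; apply: ler_sum => b _.
  by rewrite ler_wpM2r ?ler_nat // ltW ?wt_gt0.
rewrite (bigD1 v) //= [ltRHS](bigD1 v) //=; apply: ltr_leD.
  by rewrite ltr_pM2r ?wt_gt0 // ltr_nat.
by apply: ler_sum => b _; rewrite ler_wpM2r ?ler_nat // ltW ?wt_gt0.
Qed.

Lemma wsumD D D' : wsum (fun u v => D u v + D' u v) = (wsum D + wsum D')%R.
Proof.
rewrite /wsum -big_split; apply: eq_bigr => u _ /=.
by rewrite -big_split; apply: eq_bigr => v _ /=; rewrite natrD mulrDl.
Qed.

Lemma wsumZ c D : wsum (fun u v => c * D u v) = (c%:R * wsum D)%R.
Proof.
rewrite /wsum mulr_sumr; apply: eq_bigr => u _ /=.
by rewrite mulr_sumr; apply: eq_bigr => v _ /=; rewrite natrM mulrA.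
Qed.

Lemma wsum_sum (I : finType) (Di : I -> T -> T -> nat) :
  wsum (fun u v => \sum_i Di i u v) = (\sum_i wsum (Di i))%R.
Proof.
rewrite /wsum [RHS]exchange_big; apply: eq_bigr => u _ /=.
rewrite exchange_big; apply: eq_bigr => v _ /=.
by rewrite natr_sum mulr_suml.
Qed.

Lemma dominated_refl D : dominated D D.
Proof. by right. Qed.

Lemma dominated_trans D1 D2 D3 :
  dominated D1 D2 -> dominated D2 D3 -> dominated D1 D3.
Proof.
move=> [lt12|eq12] [lt23|eq23].
- by left; apply: lt_trans lt23.
- by left; rewrite -(wsum_ext eq23).
- by left; rewrite (wsum_ext eq12).
- by right=> u v; rewrite eq12.
Qed.

Lemma le_dominated D D' : (forall u v, D u v <= D' u v) -> dominated D D'.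
Proof.
move=> leD; case: (boolP [forall u, forall v, D u v == D' u v]).
  by move/forallP => h; right=> u v; apply/eqP; move/forallP: (h u); apply.
rewrite negb_forall => /existsP[u]; rewrite negb_forall => /existsP[v neD].
by left; apply: (@wsum_lt _ _ u v) => //; rewrite ltn_neqAle neD leD.
Qed.

(** If every [Di] had a sum at most that of [D], so would their weighted mean. The pointwise
    comparison may fail at some pairs: [E'] records the losses and [E] the surpluses that pay for
    them in total, on opposite sides to avoid subtraction. *)
Lemma mixture (I : finType) (c : I -> nat) (Di : I -> T -> T -> nat) D E E' :
    (forall u v, (\sum_i c i) * D u v + E u v
                 <= \sum_i c i * Di i u v + E' u v) ->
    (wsum E' <= wsum E)%R ->
    (wsum E' < wsum E)%R \/ (exists u v,
      (\sum_i c i) * D u v + E u v < \sum_i c i * Di i u v + E' u v) ->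
  exists i, (wsum D < wsum (Di i))%R.
Proof.
move=> le_mix leE lt_mix.
have lt0 : (\sum_i (c i)%:R * wsum D < \sum_i (c i)%:R * wsum (Di i))%R.
  have -> : (\sum_i (c i)%:R * wsum D = wsum (fun u v => (\sum_i c i) * D u v))%R.
    by rewrite wsumZ natr_sum mulr_suml.
  have -> : (\sum_i (c i)%:R * wsum (Di i)
             = wsum (fun u v => \sum_i c i * Di i u v))%R.
    by rewrite wsum_sum; apply: eq_bigr => i _; rewrite wsumZ.
  case: lt_mix => [ltE|[u [v lt_uv]]].
    by move: (wsum_le le_mix) ltE; rewrite !wsumD; lra.
  by move: (wsum_lt le_mix lt_uv) leE; rewrite !wsumD; lra.
case: (boolP [exists i, (wsum D < wsum (Di i))%R]) => [/existsP //|].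
rewrite negb_exists => /forallP nlt; move: lt0; rewrite ltNge => /negP[].
by apply: ler_sum => i _; rewrite ler_wpM2l // leNgt; exact: nlt.
Qed.

Lemma mixture2 a b D Da Db E E' :
    (forall u v, (a + b) * D u v + E u v
                 <= a * Da u v + b * Db u v + E' u v) ->
    (wsum E' <= wsum E)%R ->
    (wsum E' < wsum E)%R \/ (exists u v,
      (a + b) * D u v + E u v < a * Da u v + b * Db u v + E' u v) ->
  (wsum D < wsum Da)%R \/ (wsum D < wsum Db)%R.
Proof.
move=> le_mix leE lt_mix.
case: (@mixture bool (fun i => if i then a else b)
  (fun i => if i then Da else Db) D E E' _ leE).
- by move=> u v; rewrite !big_bool.
- case: lt_mix => [|[u [v h]]]; first by left.
  by right; exists u, v; rewrite !big_bool.
- by case=> h; [left|right].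
Qed.

Lemma mixture2_simple a b D Da Db :
    (forall u v, (a + b) * D u v <= a * Da u v + b * Db u v) ->
    (exists u v, (a + b) * D u v < a * Da u v + b * Db u v) ->
  dominated D Da \/ dominated D Db.
Proof.
move=> le_mix [u [v lt_mix]].
suff [h|h] : (wsum D < wsum Da)%R \/ (wsum D < wsum Db)%R.
- by left; left.
- by right; left.
apply: (@mixture2 a b _ _ _ (fun _ _ => 0) (fun _ _ => 0)) => //.
  by move=> u' v'; rewrite !addn0.
by right; exists u, v; rewrite !addn0.
Qed.

End WeightedSum.

(** * Trees hanging on a point *)

(* [Join a b] adds an edge between the roots of [a] and [b], and its root is
   that of [a]. *)
Inductive rtree (T : Type) := Leaf of T | Join of rtree T & rtree T.

Section RootedTrees.
Variable T : finType.
Implicit Types (e : rel T) (A : seq T).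

Fixpoint troot (t : rtree T) : T :=
  match t with Leaf v => v | Join a _ => troot a end.

Fixpoint tverts (t : rtree T) : seq T :=
  match t with Leaf v => [:: v] | Join a b => tverts a ++ tverts b end.

Fixpoint tedges e (t : rtree T) : bool :=
  match t with
  | Leaf _ => true
  | Join a b => [&& e (troot a) (troot b), tedges e a & tedges e b]
  end.

Fixpoint theight (t : rtree T) (u : T) : nat :=
  match t with
  | Leaf _ => 0
  | Join a b => if u \in tverts a then theight a u else (theight b u).+1
  end.

Fixpoint tdist (t : rtree T) (u v : T) : nat :=
  match t with
  | Leaf _ => 0
  | Join a b =>
    if u \in tverts a then
      if v \in tverts a then tdist a u v else theight a u + (theight b v).+1
    else
      if v \in tverts a then theight a v + (theight b u).+1 else tdist b u v
  end.

Fixpoint tinsert (p v : T) (t : rtree T) : rtree T :=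
  match t with
  | Leaf u => Join (Leaf u) (Leaf v)
  | Join a b => if p \in tverts a then Join (tinsert p v a) b
                else Join a (tinsert p v b)
  end.

Lemma troot_verts t : troot t \in tverts t.
Proof. by elim: t => [v|a IHa b _] /=; rewrite ?mem_head // mem_cat IHa. Qed.

Lemma troot_insert p v t : troot (tinsert p v t) = troot t.
Proof. by elim: t => [u|a IHa b _] //=; case: ifP. Qed.

Lemma tverts_insert p v t : perm_eq (tverts (tinsert p v t)) (v :: tverts t).
Proof.
elim: t => [u|a IHa b IHb] /=; first by rewrite (perm_catC [:: u] [:: v]).
case: ifP => _ /=; first by rewrite -cat_cons perm_cat2r.
apply: perm_trans (_ : perm_eq _ (tverts a ++ v :: tverts b)) _.
  by rewrite perm_cat2l.
by rewrite -cat1s perm_catCA.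
Qed.

Lemma tedges_insert e p v t : p \in tverts t -> e p v -> tedges e t ->
  tedges e (tinsert p v t).
Proof.
elim: t => [u|a IHa b IHb] /=; first by rewrite inE => /eqP -> ->.
rewrite mem_cat; case: ifP => [pa _|pa /= pb] epv /and3P[eab ea eb] /=.
  by rewrite troot_insert eab IHa.
by rewrite troot_insert eab ea IHb.
Qed.

Section Metric.
Variables (d : T -> T -> nat) (e : rel T).
Hypothesis d0 : forall u, d u u = 0.
Hypothesis dC : forall u v, d u v = d v u.
Hypothesis dD : forall u v z, d u z <= d u v + d v z.
Hypothesis d_edge : forall u v, e u v -> d u v <= 1.

Lemma theight_ge t u : tedges e t -> u \in tverts t ->
  d (troot t) u <= theight t u.
Proof.
elim: t => [v|a IHa b IHb] /=; first by rewrite inE => _ /eqP->; rewrite d0.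
move=> /and3P[eab ea eb]; rewrite mem_cat.
case: ifP => [ua _|_ /= ub]; first exact: IHa.
have := dD (troot a) (troot b) u; have := d_edge eab; have := IHb eb ub; lia.
Qed.

Lemma tdist_ge t u v : tedges e t -> u \in tverts t -> v \in tverts t ->
  d u v <= tdist t u v.
Proof.
elim: t => [r|a IHa b IHb] /=.
  by rewrite !inE => _ /eqP-> /eqP->; rewrite d0.
move=> /and3P[eab ea eb]; rewrite !mem_cat.
have cross w z : w \in tverts a -> z \in tverts b ->
    d w z <= theight a w + (theight b z).+1.
  move=> wa zb; have := theight_ge ea wa; have := theight_ge eb zb.
  have := d_edge eab; have := dD w (troot a) z.
  by have := dD (troot a) (troot b) z; have := dC w (troot a); lia.
case: ifP => ua /=; case: ifP => va //= ub vb.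
- exact: IHa.
- exact: cross.
- by rewrite dC; exact: cross.
- exact: IHb.
Qed.
End Metric.

Definition path_coord A (s : nat) (h : T -> nat) : Prop :=
  [/\ forall u, u \in A -> h u < s, {in A &, injective h}
    & forall k, k < s -> exists2 u, u \in A & h u = k].

(* [A] becomes a path with positions [h], hung on the rest at position [0];
   [k] is the distance from the hanging point to the outside vertices. *)
Definition rehang A (h k : T -> nat) (D : T -> T -> nat) (u v : T) : nat :=
  if u \in A then if v \in A then adist (h u) (h v) else h u + k v
  else if v \in A then h v + k u else D u v.

Definition hangs A (h k : T -> nat) (D M : T -> T -> nat) : Prop :=
  (forall u v, u \in A -> v \in A -> D u v = M u v) /\
  (forall u v, u \in A -> v \notin A -> D u v = h u + k v /\ D v u = h u + k v).

Variables (R : realFieldType) (x : T -> R).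
Hypothesis x_gt0 : forall u, (0 < x u)%R.

(** The path [A] is attached at its position [t]. Since [|p - t|] is convex in [t], averaging the
    attachments at the two ends with weights [s - 1 - t] and [t] does not decrease any distance. For
    an interior [t] the pair of the vertex at [t] and the outside vertex [o] gains strictly. *)
Lemma slide_root A s p k D D' (t : nat) (o : T) :
    path_coord A s p -> t < s -> o \notin A ->
    (forall u v, D' u v =
      if u \in A then if v \in A then adist (p u) (p v) else adist (p u) t + k v
      else if v \in A then adist (p v) t + k u else D u v) ->
  exists2 p', path_coord A s p' & dominated x D' (rehang A p' k D).
Proof.
move=> pA ts oA D'E; have [p_lt p_inj p_surj] := pA.
pose q u := s.-1 - p u.
have qA : path_coord A s q.
  split=> [u uA|u v uA vA|m ms]; first by have := p_lt u uA; rewrite /q; lia.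
    have := p_lt u uA; have := p_lt v vA; rewrite /q => lv lu eq_q.
    by apply: p_inj => //; lia.
  have [|u uA pu] := p_surj (s.-1 - m); first by lia.
  by exists u => //; rewrite /q pu; lia.
have [t0|t_gt0] := posnP t.
  exists p => //; right=> u v; rewrite D'E /rehang t0 /adist.
  by do 2 case: ifP => _; rewrite ?subn0 ?sub0n ?addn0.
have [tN|t_ltN] := leqP s.-1 t.
  exists q => //; right=> u v; rewrite D'E /rehang /adist /q.
  case: ifP => uA; case: ifP => vA //.
  - by have := p_lt u uA; have := p_lt v vA; lia.
  - by have := p_lt u uA; lia.
  - by have := p_lt v vA; lia.
have conv z : z < s -> s.-1 * adist z t <= (s.-1 - t) * z + t * (s.-1 - z).
  move=> zs; have -> : s.-1 = (s.-1 - z) + z by lia.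
  have : z <= s.-1 by lia.
  rewrite /adist; move: (s.-1) t_ltN => N tN zN.
  by have [zt|tz] := leqP z t; nia.
case: (@mixture2_simple _ _ _ x_gt0 (s.-1 - t) t D'
         (rehang A p k D) (rehang A q k D)) => [u v||domP|domP].
- have -> : s.-1 - t + t = s.-1 by lia.
  rewrite D'E /rehang; case: ifP => uA; case: ifP => vA.
  + have -> : adist (q u) (q v) = adist (p u) (p v).
      by rewrite /adist /q; have := p_lt u uA; have := p_lt v vA; lia.
    by rewrite -mulnDl; nia.
  + by have := conv _ (p_lt u uA); rewrite /q; move: (adist _ _) => z; nia.
  + by have := conv _ (p_lt v vA); rewrite /q; move: (adist _ _) => z; nia.
  + by nia.
- have [|u uA pu] := p_surj t; first by lia.
  exists u, o; rewrite D'E /rehang uA (negbTE oA) /q pu.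
  have -> : adist t t = 0 by rewrite /adist; lia.
  by nia.
- by exists p.
- by exists q.
Qed.

(** By induction on joins: each of the two subtrees becomes a path, everything else being outside,
    and the path that they form together is slid to one of its ends. *)
Lemma tree_to_path t D k o : uniq (tverts t) -> o \notin tverts t ->
    hangs (tverts t) (theight t) k D (tdist t) ->
  exists s, exists2 h, path_coord (tverts t) s h &
    dominated x D (rehang (tverts t) h k D).
Proof.
elim: t D k o => [r|a IHa b IHb] D k o /=.
  move=> _ o_r [Dr Dk]; exists 1, (fun _ => 0).
    split=> // [u v|[|//] _]; first by rewrite !inE => /eqP-> /eqP->.
    by exists r; rewrite ?mem_head.
  right=> u v; rewrite /rehang.
  case: ifP => uA; case: ifP => vA //.
  - by rewrite Dr.
  - by have [] := Dk u v uA (negbT vA).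
  - by have [] := Dk v u vA (negbT uA).
rewrite cat_uniq mem_cat => /and3P[uniq_a disj uniq_b] /norP[oa ob].
have dab u : u \in tverts a -> (u \in tverts b) = false.
  by move=> ua; apply: contraNF disj => ub; apply/hasP; exists u.
case=> Dm Dk.
(* Seen from [a], the tree [b] is part of the outside, one edge beyond the root of [a]. *)
pose k1 v := if v \in (tverts b) then (theight b v).+1 else k v.
have [|sa [ha ha_coord dom1]] := IHa D k1 o uniq_a oa.
  split=> [u v ua va|u v ua va].
    by rewrite Dm ?mem_cat ?ua ?va //= ua va.
  rewrite /k1; case: ifP => vB.
    by rewrite !Dm ?mem_cat ?ua ?vB ?orbT //= ?ua ?(negbTE va) //= addnS.
  by have [||-> ->] := Dk u v; rewrite ?mem_cat ?ua ?(negbTE va) ?vB.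
set D1 := rehang (tverts a) ha k1 D in dom1.
pose k2 v := if v \in (tverts a) then (ha v).+1 else (k v).+1.
have BA u : u \in (tverts b) -> (u \in tverts a) = false.
  by move=> ub; apply/negP => /dab; rewrite ub.
have [|sb [hb hb_coord dom2]] := IHb D1 k2 o uniq_b ob.
  split=> [u v ub vb|u v ub vb].
    rewrite /D1 /rehang !BA // Dm ?mem_cat ?ub ?vb ?orbT //.
    by rewrite !BA.
  rewrite /D1 /rehang /k2 /k1 ub (BA u ub).
  have [vA|vA] := boolP (v \in tverts a).
    by split; lia.
  have uab : u \in tverts a ++ tverts b by rewrite mem_cat ub orbT.
  have vab : v \notin tverts a ++ tverts b by rewrite mem_cat (negbTE vA).
  have [-> ->] := Dk u v uab vab.
  by rewrite (BA u ub); split; lia.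

set D2 := rehang (tverts b) hb k2 D1 in dom2.
have [a_lt a_inj a_surj] := ha_coord; have [b_lt b_inj b_surj] := hb_coord.
have sa_gt0 : 0 < sa by have := a_lt _ (troot_verts a); lia.
(* The path of [a] read backwards, followed by that of [b], has the two roots side by side at
   [sa - 1] and [sa]. The union is one path, attached at position [sa - 1]. *)
pose p u := if u \in (tverts a) then sa.-1 - ha u else sa + hb u.
have [||||h h_coord dom3] := @slide_root ((tverts a) ++ (tverts b)) (sa + sb) p k D D2 sa.-1 o.
- split=> [u|u v|m]; rewrite ?mem_cat /p.
  + by case: ifP => [/a_lt|_ /= /b_lt]; lia.
  + case: ifP => uA; case: ifP => vA //= ub vb.
    * by have := a_lt u uA; have := a_lt v vA => *; apply: a_inj => //; lia.
    * by have := a_lt u uA; lia.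
    * by have := a_lt v vA; lia.
    * by move=> /addnI; apply: b_inj.
  + have [m_lt|m_ge] := ltnP m sa => ms.
      have [|u uA hu] := a_surj (sa.-1 - m); first by lia.
      by exists u; rewrite ?mem_cat uA //; lia.
    have [|u uB hu] := b_surj (m - sa); first by lia.
    by exists u; rewrite ?mem_cat BA ?uB //; lia.
- by lia.
- by rewrite mem_cat negb_or oa.
- move=> u v; rewrite /D2 /D1 /rehang /k2 /k1 /p !mem_cat.
  have cls w : [\/ (w \in tverts a) = true /\ (w \in tverts b) = false,
      (w \in tverts a) = false /\ (w \in tverts b) = true
    | (w \in tverts a) = false /\ (w \in tverts b) = false].
    have [wa|wa] := boolP (w \in tverts a).
      by constructor 1; rewrite dab.
    by case: (w \in tverts b); [constructor 2|constructor 3].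
  case: (cls u) => -[uA uB]; case: (cls v) => -[vA vB];
    rewrite ?uA ?uB ?vA ?vB //= /adist;
    try (have := a_lt u uA); try (have := a_lt v vA);
    try (have := b_lt u uB); try (have := b_lt v vB); lia.
exists (sa + sb), h => //.
exact: dominated_trans dom1 (dominated_trans dom2 dom3).
Qed.

End RootedTrees.

(** * Paths hanging on a cycle *)

Section Blocks.
Variable T : finType.
Implicit Types (S : nat -> nat -> nat) (b h : T -> nat).

(* Blocks [b u = i] are paths with positions [h], hung at position [0] on the
   points of a metric [S]. *)
Definition block_dist S b h (u v : T) : nat :=
  if b u == b v then adist (h u) (h v) else h u + h v + S (b u) (b v).

Definition path_blocks (g : nat) (sz : nat -> nat) b h : Prop :=
  [/\ forall u, b u < g /\ h u < sz (b u),
      forall u v, b u = b v -> h u = h v -> u = v,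
      forall i k, i < g -> k < sz i -> exists2 u, b u = i & h u = k
    & forall i, i < g -> 0 < sz i].

Variables (R : realFieldType) (x : T -> R).
Hypothesis x_gt0 : forall u, (0 < x u)%R.

Variables (d : T -> T -> nat) (e : rel T) (g : nat) (c : nat -> T).
Variable S : nat -> nat -> nat.
Hypothesis d0 : forall u, d u u = 0.
Hypothesis dC : forall u v, d u v = d v u.
Hypothesis dD : forall u v z, d u z <= d u v + d v z.
Hypothesis d_edge : forall u v, e u v -> d u v <= 1.
Hypothesis e_conn : forall u v, connect e u v.
Hypothesis g_gt1 : 1 < g.
Hypothesis c_inj : forall i j, i < g -> j < g -> c i = c j -> i = j.
Hypothesis SC : forall i j, S i j = S j i.
Hypothesis d_c : forall i j, i < g -> j < g -> i <> j -> d (c i) (c j) <= S i j.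

Definition rooted_forest (ts : nat -> rtree T) : Prop :=
  (forall i, i < g ->
     [/\ troot (ts i) = c i, tedges e (ts i) & uniq (tverts (ts i))]) /\
  (forall i j u, i < g -> j < g ->
     u \in tverts (ts i) -> u \in tverts (ts j) -> i = j).

Let covered (ts : nat -> rtree T) : pred T :=
  fun u => has (fun i => u \in tverts (ts i)) (iota 0 g).

Let coveredP ts u :
  reflect (exists2 i, i < g & u \in tverts (ts i)) (covered ts u).
Proof.
apply: (iffP hasP) => [[i]|[i ig ui]]; first by rewrite mem_iota => /andP[_ ?]; exists i.
by exists i; rewrite ?mem_iota.
Qed.

(** The forest grows one leaf at a time from the points [c i]. When no edge leaves the covered set,
    connectivity makes it everything. *)
Lemma rooted_forest_cover : exists2 ts, rooted_forest ts &
  forall u, exists2 i, i < g & u \in tverts (ts i).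
Proof.
suff [ts fts all_cov] : exists2 ts, rooted_forest ts & forall u, covered ts u.
  by exists ts => // u; exact/coveredP.
have [m] : exists m, exists2 ts, rooted_forest ts & #|predC (covered ts)| <= m.
  exists #|T|, (fun i => Leaf (c i)); last exact: max_card.
  split=> [i ig|i j u ig jg] //=.
  by rewrite !inE => /eqP -> /eqP; exact: c_inj.
elim: m => [|m IHm] [ts fts le_m].
  exists ts => // u; move: le_m; rewrite leqn0 => /eqP/card0_eq/(_ u).
  by rewrite inE => /negbFE.
case: (boolP [exists u, exists v, [&& covered ts u, ~~ covered ts v & e u v]]);
    last first.
  rewrite negb_exists => /forallP closed_cov; exists ts => // v.
  have c0 : covered ts (c 0).
    have [/(_ 0 (ltnW g_gt1)) [r0 _ _] _] := fts.
    by apply/coveredP; exists 0; rewrite -?r0 ?troot_verts // ltnW.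
  have /connectP[p] := e_conn (c 0) v.
  elim: p (c 0) c0 => [|w p IHp] u cu /= => [_ -> //|/andP[euw pw] vE].
  apply: (IHp w) => //; apply: contraT => ncw.
  by have := closed_cov u; rewrite negb_exists => /forallP/(_ w); rewrite cu ncw euw.
case/existsP => u /existsP[v /and3P[/coveredP[k kg uk] ncv euv]].
have ncvi i : i < g -> v \notin tverts (ts i).
  by move=> ig; apply: contra ncv => vi; apply/coveredP; exists i.
pose ts' i := if i == k then tinsert u v (ts k) else ts i.
have mem_ts' i w : (w \in tverts (ts' i)) =
    ((i == k) && (w == v)) || (w \in tverts (ts i)).
  rewrite /ts'; case: eqP => [->|//].
  by rewrite (perm_mem (tverts_insert u v (ts k))) inE.
have [f_ok f_disj] := fts.
apply: IHm; exists ts'.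
  split=> [i ig|i j w ig jg].
    rewrite /ts'; case: eqP => [->|_]; last exact: f_ok.
    have [r_k e_k u_k] := f_ok k kg; split.
    - by rewrite troot_insert.
    - exact: tedges_insert.
    - by rewrite (perm_uniq (tverts_insert u v (ts k))) /= ncvi.
  rewrite !mem_ts' => /orP[/andP[/eqP-> /eqP->]|wi].
    case/orP => [/andP[/eqP-> //]|vj]; by rewrite (negbTE (ncvi j jg)) in vj.
  case/orP => [/andP[/eqP jk /eqP wv]|wj]; last exact: f_disj wi wj.
  by rewrite wv (negbTE (ncvi i ig)) in wi.
rewrite -ltnS; apply: leq_trans le_m; apply: proper_card; apply/fintype.properP; split.
  apply/fintype.subsetP => w; rewrite !inE; apply: contra => /coveredP[i ig wi].
  by apply/coveredP; exists i; rewrite // mem_ts' wi orbT.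
exists v; rewrite inE // negbK; apply/coveredP.
by exists k; rewrite // mem_ts' !eqxx.
Qed.

(** A spanning forest rooted at the points [c i] bounds [d] from above: go up to the root, cross
    between roots at cost [S], go down. Its trees are then turned into paths. *)
Lemma dominated_by_path_blocks : exists sz b h,
  path_blocks g sz b h /\ dominated x d (block_dist S b h).
Proof.
have [ts [f_ok f_disj] f_cov] := rooted_forest_cover.
pose b u := find (fun i => u \in tverts (ts i)) (iota 0 g).
have b_lt u : b u < g.
  have [i ig ui] := f_cov u; rewrite -[X in _ < X](size_iota 0) -has_find.
  by apply/hasP; exists i; rewrite ?mem_iota.
have b_mem u : u \in tverts (ts (b u)).
  have := b_lt u; rewrite -[X in _ < X](size_iota 0) -has_find => hu.
  by have := nth_find 0 hu; rewrite nth_iota; [rewrite add0n|exact: b_lt].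
have bE u i : i < g -> u \in tverts (ts i) = (b u == i).
  move=> ig; apply/idP/eqP => [ui|<- //].
  exact: (@f_disj (b u) i u (b_lt u) ig (b_mem u) ui).
pose D0 u v := if b u == b v then tdist (ts (b u)) u v
  else theight (ts (b u)) u + theight (ts (b v)) v + S (b u) (b v).
have dom0 : dominated x d D0.
  apply: le_dominated => // u v; rewrite /D0; case: eqP => buv.
    have [_ ek _] := f_ok _ (b_lt u).
    by apply: (tdist_ge d0 dC dD d_edge ek) => //; rewrite buv.
  have [ru eu _] := f_ok _ (b_lt u); have [rv ev _] := f_ok _ (b_lt v).
  have := theight_ge d0 dD d_edge eu (b_mem u).
  have := theight_ge d0 dD d_edge ev (b_mem v).
  have := d_c (b_lt u) (b_lt v) buv; rewrite ru rv.
  have := dD u (c (b u)) v; have := dD (c (b u)) (c (b v)) v.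
  by have := dC u (c (b u)); lia.
(* Invariant: the trees of index below [m] are already paths and the others keep their tree
   distances. The partition [b] into blocks never changes. *)
suff main m : m <= g -> exists sz h D, dominated x d D /\
    [/\ forall u v, b u != b v -> D u v = h u + h v + S (b u) (b v),
        forall u v, b u = b v -> b u < m -> D u v = adist (h u) (h v),
        forall u v, b u = b v -> m <= b u -> D u v = tdist (ts (b u)) u v,
        forall u, m <= b u -> h u = theight (ts (b u)) u
      & forall i, i < m -> path_coord (tverts (ts i)) (sz i) h].
  have [sz [h [D [dom [D_neq D_eq _ _ coord]]]]] := main g (leqnn g).
  exists sz, b, h; split; last first.
    apply: dominated_trans dom _; right=> u v; rewrite /block_dist.
    by case: eqP => buv; [rewrite D_eq|rewrite D_neq //; apply/eqP].
  split=> [u|u v buv|i k ig|i ig].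
  - by have [lt_h _ _] := coord _ (b_lt u); rewrite lt_h.
  - have [_ inj_h _] := coord _ (b_lt u); apply: inj_h => //.
    by rewrite buv.
  - have [_ _ surj_h] := coord _ ig => /surj_h[u].
    by rewrite bE // => /eqP bu hu; exists u.
  - have [lt_h _ _] := coord _ ig; have := lt_h _ (troot_verts (ts i)).
    by lia.
elim: m => [_|m IHm m_lt].
  exists (fun=> 0), (fun u => theight (ts (b u)) u), D0; split=> //.
  by split=> // u v buv; rewrite /D0 ?buv ?eqxx // (negbTE buv).
have [sz [h [D [dom [D_neq D_eq D_tree h_tree coord]]]]] := IHm (ltnW m_lt).
(* The outside vertex is the root of tree 0, or of tree 1 when [m = 0]; the boolean [m == 0] is read
   as an index. *)
have [o om] : exists o, o \notin tverts (ts m).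
  exists (c (m == 0)); rewrite bE //; apply/eqP => bc.
  have m0_lt : (m == 0) < g by case: (m == 0); lia.
  have [rc _ _] := f_ok _ m0_lt.
  have := bE (c (m == 0)) _ m0_lt; rewrite -rc troot_verts rc bc => /esym/eqP.
  by case: (m) => //=.
have [_ _ uniq_m] := f_ok _ m_lt.
pose k v := h v + S m (b v).
have [|s [h' h'_coord dom']] := tree_to_path x_gt0 (D := D) (k := k) uniq_m om.
  split=> u v; rewrite !bE // => /eqP bu.
    by move=> /eqP bv; rewrite D_tree ?bu ?bv.
  move=> bv; have uv : b u != b v by rewrite bu eq_sym.
  have vu : b v != b u by rewrite eq_sym.
  have hu := h_tree u; rewrite bu in hu; rewrite -hu // /k.
  by rewrite (D_neq _ _ uv) (D_neq _ _ vu) (SC (b v)) bu; split; lia.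
exists (fun i => if i == m then s else sz i).
exists (fun u => if b u == m then h' u else h u).
exists (rehang (tverts (ts m)) h' k D); split.
  exact: dominated_trans dom dom'.
split.
- move=> u v buv; rewrite /rehang !bE // /k.
  case: eqP => bu; case: eqP => bv.
  + by rewrite bu bv eqxx in buv.
  + by rewrite -bu; lia.
  + by rewrite -bv (SC (b u)); lia.
  + exact: D_neq.
- move=> u v buv; rewrite ltnS leq_eqVlt /rehang !bE // -buv.
  by case: eqP => //= bu /D_eq; apply.
- move=> u v buv bu; rewrite /rehang !bE // -buv gtn_eqF //.
  by apply: D_tree => //; exact: ltnW.
- by move=> u bu; rewrite gtn_eqF // h_tree // ltnW.
- move=> i; rewrite ltnS leq_eqVlt => /predU1P[->|im].
    rewrite eqxx; have [h_lt h_inj h_surj] := h'_coord; split.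
    + by move=> u um; move: (um); rewrite bE // => ->; exact: h_lt.
    + move=> u v um vm; move: (um) (vm); rewrite !bE // => -> ->.
      exact: h_inj.
    + move=> q /h_surj[u um hu]; exists u => //.
      by move: um; rewrite bE // => ->.
  have ig : i < g by exact: leq_trans im (ltnW m_lt).
  rewrite ltn_eqF //; have [h_lt h_inj h_surj] := coord _ im.
  have nm u : u \in tverts (ts i) -> (b u == m) = false.
    by rewrite bE // => /eqP->; rewrite ltn_eqF.
  split.
  + by move=> u ui; rewrite nm //; exact: h_lt.
  + by move=> u v ui vi; rewrite !nm //; exact: h_inj.
  + by move=> q /h_surj[u ui hu]; exists u => //; rewrite nm.
Qed.

End Blocks.

(** * Sliding along a path; triangles *)

(* Distance from position [p] of a path to an outside point hung on the edge
   [j, j + 1], at distance [s] from [j] and [t] from [j + 1]. *)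
Definition edge_dist (s t j p : nat) : nat :=
  if p <= j then s + (j - p) else t + (p - j.+1).

(** As a function of [j], the distance has slope -1 while [j + 1 < p], then one step of [s - t],
    then slope 1. It is convex because [|s - t| <= 1]. *)
Lemma edge_dist_conv s t N j p : s <= t.+1 -> t <= s.+1 -> j < N -> p <= N.+1 ->
  N * edge_dist s t j p
  <= (N - j) * edge_dist s t 0 p + j * edge_dist s t N p.
Proof.
move=> st ts jN pN; rewrite /edge_dist.
have [r ?] : exists r, N = j + r by exists (N - j); lia.
subst N.
have -> : j + r - j = r by lia.
have [pj|jp] := leqP p j.
  have [->|p_gt0] := posnP p; first by rewrite !leq0n !subn0; nia.
  rewrite leqn0 gtn_eqF //= ifT; last by lia.
  have [q ?] : exists q, p = q.+1 by exists p.-1; lia.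
  subst p.
  by nia.
rewrite leqn0 gtn_eqF ?(leq_ltn_trans _ jp) //=.
have [pjr|pjr] := leqP p (j + r); last first.
  have -> : p = (j + r).+1 by lia.
  by nia.
have [q [q' [? ?]]] : exists q q', p = j.+1 + q /\ r = q.+1 + q'.
  by exists (p - j.+1), (r - (p - j)); lia.
subst p r; nia.
Qed.

(** At one of the two ends of the hanging edge, the one nearer to the outside point, the slope
    increases strictly at [j]. *)
Lemma edge_dist_conv_lt s t N j : s <= t.+1 -> t <= s.+1 -> 0 < j < N ->
  let p := if s <= t then j else j.+1 in
  N * edge_dist s t j p
  < (N - j) * edge_dist s t 0 p + j * edge_dist s t N p.
Proof.
move=> st ts /andP[j_gt0 jN]; rewrite /edge_dist.
have [r ?] : exists r, N = j + r.+1 by exists (N - j).-1; lia.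
subst N.
have -> : j + r.+1 - j = r.+1 by lia.
case: (leqP s t) => cmp /=.
  rewrite leqnn leqn0 gtn_eqF //= ifT; last by lia.
  have [q ?] : exists q, j = q.+1 by exists j.-1; lia.
  subst j.
  by nia.
rewrite ltnn /= ifT; last by lia.
by nia.
Qed.

Lemma surj_lt_card (T : finType) (p : T -> nat) N :
  (forall k, k < N -> exists u, p u = k) -> N <= #|T|.
Proof.
move=> p_surj; rewrite -(size_iota 0 N) cardT -(size_map p).
apply: uniq_leq_size (iota_uniq _ _) _ => k; rewrite mem_iota => /p_surj[u <-].
by apply/mapP; exists u; rewrite ?mem_enum.
Qed.

(** The kite seen as the path 0, 1, 2, ... with the chord {0, 2}, which saves one step from 0 to
    every vertex beyond 1. *)
Definition kite_dist (i j : nat) : nat :=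
  adist i j - ((i == 0) && (1 < j) || (j == 0) && (1 < i)).

Lemma kite_distC i j : kite_dist i j = kite_dist j i.
Proof. by rewrite /kite_dist /adist addnC orbC. Qed.

Lemma kite_dist0 r : kite_dist 0 r = r - (1 < r).
Proof. by rewrite /kite_dist /adist /= sub0n subn0 andbF orbF. Qed.

Lemma kite_dist0S i : kite_dist 0 i.+1 = maxn i 1.
Proof. by rewrite kite_dist0; lia. Qed.

Lemma kite_distSS i j : kite_dist i.+1 j.+1 = adist i j.
Proof. by rewrite /kite_dist /adist /= !subSS subn0. Qed.

Definition cycle_dist (g i j : nat) : nat := minn (adist i j) (g - adist i j).

Lemma cycle_distC g i j : cycle_dist g i j = cycle_dist g j i.
Proof. by rewrite /cycle_dist /adist addnC. Qed.

Section Slides.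
Variables (T : finType) (R : realFieldType) (x : T -> R).
Hypothesis x_gt0 : forall u, (0 < x u)%R.
Implicit Types (S : nat -> nat -> nat) (b h p : T -> nat).

Definition kite_like (D : T -> T -> nat) : Prop :=
  exists p, [/\ injective p, forall u, p u < #|T| &
    dominated x D (fun u v => kite_dist (p u) (p v))].

Lemma kite_likeW D D' : dominated x D D' -> kite_like D' -> kite_like D.
Proof.
move=> domD [p [p_inj p_lt dom_p]]; exists p; split=> //.
exact: dominated_trans domD dom_p.
Qed.

(** The blocks [a] and [c], joined at their roots, form one path, and all the other blocks hang on
    its edge between the two roots. By convexity this edge can be moved to an end of the path, where
    one of the two blocks has a single vertex. The third block [o] supplies the strict gain. *)
Lemma slide_edge S g sz b h a c o :
    path_blocks g sz b h -> a < g -> c < g -> a != c ->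
    o < g -> o != a -> o != c ->
    (forall i j, S i j = S j i) -> S a c = 1 ->
    (forall i, i < g -> i != a -> i != c ->
       S i a <= (S i c).+1 /\ S i c <= (S i a).+1) ->
  exists sz' b' h', [/\ path_blocks g sz' b' h',
    dominated x (block_dist S b h) (block_dist S b' h'),
    forall i, i != a -> i != c -> sz' i = sz i & sz' a = 1 \/ sz' c = 1].
Proof.
move=> [b_h inj_bh surj_bh sz_gt0] ag cg ac og oa oc SC Sac S_lip.
pose Z u := (b u == a) || (b u == c).
pose p u := if b u == a then (sz a).-1 - h u else sz a + h u.
have sa_gt0 := sz_gt0 a ag; have sc_gt0 := sz_gt0 c cg.
pose N := (sz a + sz c).-2.
have Zcase u : Z u -> [/\ b u = a, h u < sz a & p u = (sz a).-1 - h u] \/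
    [/\ b u = c, h u < sz c & p u = sz a + h u].
  have := (b_h u).2; rewrite /Z /p; case: eqP => [->|_] lt_h; first by left.
  by move=> /eqP buc; right; rewrite buc in lt_h *.
have p_lt u : Z u -> p u <= N.+1.
  by move=> /Zcase[] [_ hu ->]; rewrite /N; lia.
have p_inj u v : Z u -> Z v -> p u = p v -> u = v.
  by move=> /Zcase[] [bu hu ->] /Zcase[] [bv hv ->] puv; apply: inj_bh; lia.
have p_surj k : k <= N.+1 -> exists2 u, Z u & p u = k.
  rewrite /Z /p /N => kN; have [ka|ak] := ltnP k (sz a).
    have [|u bu hu] := surj_bh a ((sz a).-1 - k) ag; first by lia.
    by exists u; rewrite bu eqxx // hu; lia.
  have [|u bu hu] := surj_bh c (k - sz a) cg; first by lia.
  by exists u; rewrite bu ?eqxx ?orbT // 1?eq_sym ?(negbTE ac) ?hu; lia.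
(* The configuration with the hanging edge at [[j, j + 1]]: positions up to [j] form block [a], the
   later ones block [c]. The original one is [j = sz a - 1]. *)
pose bj j u := if Z u then if p u <= j then a else c else b u.
pose hj j u := if Z u then if p u <= j then j - p u else p u - j.+1 else h u.
pose szj j i := if i == a then j.+1 else if i == c then N.+1 - j else sz i.
have bjZ j u : (bj j u == a) || (bj j u == c) = Z u.
  rewrite /bj; case Zu: (Z u) => //.
  by case: ifP; rewrite eqxx ?orbT.
have pb_j j : j <= N -> path_blocks g (szj j) (bj j) (hj j).
  move=> jN; split.
  - move=> u; rewrite /bj /hj /szj; case Zu: (Z u).
      have pu := p_lt u Zu; case: (leqP (p u) j) => _; rewrite ?eqxx.
        by split=> //; lia.
      by rewrite eq_sym (negbTE ac); split=> //; lia.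
    by move: Zu => /norP[/negbTE-> /negbTE->].
  - move=> u v buv; have Zuv : Z u = Z v by rewrite -!(bjZ j) buv.
    move: buv; rewrite /bj /hj Zuv; case Zv: (Z v); last exact: inj_bh.
    have ac' := elimN eqP ac.
    by case: (leqP (p u) j) => pu; case: (leqP (p v) j) => pv // *;
      apply: p_inj => //; lia.
  - move=> i k ig; rewrite /szj; case: eqP => [->|ia].
      move=> kj; have [|u Zu pu] := p_surj (j - k); first by lia.
      by exists u; rewrite /bj /hj Zu pu leq_subr //; lia.
    case: eqP => [->|ic] ki.
      have [|u Zu pu] := p_surj (j.+1 + k); first by lia.
      by exists u; rewrite /bj /hj Zu pu ifF //; lia.
    have [u bu hu] := surj_bh i k ig ki.
    have Zu : Z u = false by rewrite /Z bu; lia.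
    by exists u; rewrite /bj /hj Zu.
  - by move=> i ig; rewrite /szj; do 2 case: eqP => // _; [lia|exact: sz_gt0].
have [s1|sa_neq1] := eqVneq (sz a) 1.
  by exists sz, b, h; split=> //; [exact: dominated_refl|left].
have [s1|sc_neq1] := eqVneq (sz c) 1.
  by exists sz, b, h; split=> //; [exact: dominated_refl|right].
pose j0 := (sz a).-1.
have j0_lt : 0 < j0 < N by rewrite /j0 /N; lia.
have DE j u v : j <= N -> block_dist S (bj j) (hj j) u v =
    if Z u then if Z v then adist (p u) (p v)
                else h v + edge_dist (S (b v) a) (S (b v) c) j (p u)
    else if Z v then h u + edge_dist (S (b u) a) (S (b u) c) j (p v)
    else block_dist S b h u v.
  move=> jN; rewrite /block_dist /bj /hj /edge_dist.
  case Zu: (Z u); case Zv: (Z v) => //.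
  - have [pu|pu] := leqP (p u) j; have [pv|pv] := leqP (p v) j;
      rewrite ?eqxx ?(negbTE ac) 1?eq_sym ?(negbTE ac) ?(SC c) ?Sac /adist; lia.
  - move: Zv => /norP[/negbTE va /negbTE vc].
    by case: (leqP (p u) j) => pu; rewrite eq_sym ?va ?vc (SC _ (b v)); lia.
  - move: Zu => /norP[/negbTE ua /negbTE uc].
    by case: (leqP (p v) j) => pv; rewrite ?ua ?uc; lia.
have D0E u v : block_dist S b h u v = block_dist S (bj j0) (hj j0) u v.
  have ext w : b w = bj j0 w /\ h w = hj j0 w.
    rewrite /bj /hj /Z /p /j0; have := (b_h w).2.
    case: eqP => [->|ba] /=; first by move=> hw; rewrite leq_subr; lia.
    have -> : (sz a + h w <= (sz a).-1) = false by lia.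
    by case: eqP => [-> _|//]; lia.
  have [bu hu] := ext u; have [bv hv] := ext v.
  by rewrite /block_dist bu hu bv hv.
have zN : 0 <= N by [].
have jN : j0 <= N by lia.
suff [dom|dom] : dominated x (block_dist S b h) (block_dist S (bj 0) (hj 0)) \/
    dominated x (block_dist S b h) (block_dist S (bj N) (hj N)).
- exists (szj 0), (bj 0), (hj 0); split=> //.
  + exact: pb_j.
  + by move=> i /negbTE ia /negbTE ic; rewrite /szj ia ic.
  + by left; rewrite /szj eqxx.
- exists (szj N), (bj N), (hj N); split=> //.
  + exact: pb_j.
  + by move=> i /negbTE ia /negbTE ic; rewrite /szj ia ic.
  + by right; rewrite /szj eqxx eq_sym (negbTE ac); lia.
have NE : N - j0 + j0 = N by lia.
apply: (mixture2_simple x_gt0 (a := N - j0) (b := j0)) => [u v|].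
  rewrite NE D0E !DE //; case Zu: (Z u); case Zv: (Z v).
  - by rewrite -mulnDl NE.
  - move: Zv => /norP[va vc]; have [l1 l2] := S_lip _ (b_h v).1 va vc.
    have := @edge_dist_conv _ _ N j0 (p u) l1 l2 _ (p_lt u Zu).
    by move=> /(_ ltac:(lia)); nia.
  - move: Zu => /norP[ua uc]; have [l1 l2] := S_lip _ (b_h u).1 ua uc.
    have := @edge_dist_conv _ _ N j0 (p v) l1 l2 _ (p_lt v Zv).
    by move=> /(_ ltac:(lia)); nia.
  - by rewrite -mulnDl NE.
have [l1 l2] := S_lip o og oa oc.
have [v bv _] := surj_bh o 0 og (sz_gt0 o og).
have [|u Zu pu] := p_surj (if S o a <= S o c then j0 else j0.+1).
  by case: ifP; lia.
exists u, v; rewrite NE D0E !DE // Zu.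
have -> : Z v = false by rewrite /Z bv (negbTE oa) (negbTE oc).
rewrite bv pu; have := edge_dist_conv_lt l1 l2 j0_lt.
by move: (if _ then _ else _) => q; nia.
Qed.

Lemma kite_of_singles S sz b h a c o :
    path_blocks 3 sz b h -> (forall i, i < 3 -> [\/ i = a, i = c | i = o]) ->
    a < 3 -> c < 3 -> o < 3 -> uniq [:: a; c; o] -> sz a = 1 -> sz c = 1 ->
    (forall i j, i < 3 -> j < 3 -> i != j -> S i j = 1) ->
  kite_like (block_dist S b h).
Proof.
move=> [b_h inj_bh surj_bh _] aco a3 c3 o3 /= uaco sza szc S1.
have [ca [oa oc]] : (c == a) = false /\ (o == a) = false /\ (o == c) = false.
  by move: uaco; rewrite !inE; lia.
have bP u : [\/ b u = a /\ h u = 0, b u = c /\ h u = 0 | b u = o].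
  have [lt_b] := b_h u; case: (aco _ lt_b) => bu; rewrite bu ?sza ?szc => lt_h.
  - by constructor 1; split; lia.
  - by constructor 2; split; lia.
  - by constructor 3.
pose p u := if b u == a then 0 else if b u == c then 1 else (h u).+2.
have p_inj : injective p.
  move=> u v; rewrite /p.
  case: (bP u) => [[bu hu]|[bu hu]|bu]; case: (bP v) => [[bv hv]|[bv hv]|bv];
    rewrite bu bv ?eqxx ?ca ?oa ?oc // => puv; apply: inj_bh; lia.
exists p; split=> // [u|].
  apply: (@leq_ltn_trans (p u)) => //.
  have : (sz o).+2 <= #|T|.
    apply: (@surj_lt_card _ p) => k k_lt.
    have [->|k0] := eqVneq k 0.
      have [|w bw _] := surj_bh a 0 a3; first by rewrite sza.
      by exists w; rewrite /p bw eqxx.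
    have [->|k1] := eqVneq k 1.
      have [|w bw _] := surj_bh c 0 c3; first by rewrite szc.
      by exists w; rewrite /p bw eqxx ca.
    have [|w bw hw] := surj_bh o k.-2 o3; first by lia.
    by exists w; rewrite /p bw oa oc hw; lia.
  have := (b_h u).2; rewrite /p.
  by case: (bP u) => [[-> _]|[-> _]|->]; rewrite ?eqxx ?ca ?oa ?oc; lia.
right=> u v; rewrite /block_dist /p.
case: (bP u) => [[bu hu]|[bu hu]|bu]; case: (bP v) => [[bv hv]|[bv hv]|bv];
  rewrite bu bv ?hu ?hv ?eqxx ?(eq_sym a) ?(eq_sym c o) ?ca ?oa ?oc ?S1 //;
  rewrite 1?eq_sym ?ca ?oa ?oc // /kite_dist /adist; lia.
Qed.

(** Two slides suffice: the first makes one of the blocks 0 and 1 a single vertex, the second does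
    so for the other one or for block 2, leaving a single path. *)
Lemma kite_of_triangle S sz b h : path_blocks 3 sz b h ->
    (forall i j, S i j = S j i) ->
    (forall i j, i < 3 -> j < 3 -> i != j -> S i j = 1) ->
  kite_like (block_dist S b h).
Proof.
move=> pb SC S1.
have S_lip a c i : a < 3 -> c < 3 -> i < 3 -> i != a -> i != c ->
    S i a <= (S i c).+1 /\ S i c <= (S i a).+1.
  by move=> a3 c3 i3 ia ic; rewrite !S1.
have [||sz1 [b1 [h1 [pb1 dom1 _ sz1E]]]] :=
  @slide_edge S 3 sz b h 0 1 2 pb isT isT isT isT isT isT SC.
- exact: S1.
- by move=> i; exact: S_lip.
apply: kite_likeW dom1 _.
have [s [o [s3 o3 sz1s so]]] : exists s o,
    [/\ s < 2, o < 2, sz1 s = 1 & s != o].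
  by case: sz1E => e1; [exists 0, 1|exists 1, 0].
have [|||||||sz2 [b2 [h2 [pb2 dom2 sz2s sz2E]]]] :=
  @slide_edge S 3 sz1 b1 h1 o 2 s pb1 _ isT _ _ _ _ SC; try lia.
- by apply: S1; lia.
- by move=> i; apply: S_lip; lia.
apply: kite_likeW dom2 _.
have sz2s1 : sz2 s = 1 by rewrite sz2s //; lia.
have cover i : i < 3 -> [\/ i = s, i = o | i = 2].
  move=> i3; have [->|is_] := eqVneq i s; first by constructor 1.
  have [->|io] := eqVneq i o; first by constructor 2.
  by constructor 3; lia.
have uniq_so2 : uniq [:: s; o; 2] /\ uniq [:: s; 2; o].
  by split; rewrite /= !inE; lia.
case: sz2E => sz2o.
  by apply: (kite_of_singles pb2 cover _ _ _ uniq_so2.1) => //; lia.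
apply: (kite_of_singles pb2 _ _ _ _ uniq_so2.2) => //; try lia.
by move=> i /cover[]; [constructor 1|constructor 3|constructor 2].
Qed.

End Slides.

(** * Cycles of length four *)

Lemma cycle_dist4_odd i j : i < 4 -> j < 4 -> odd i != odd j ->
  cycle_dist 4 i j = 1.
Proof. by case: i => [|[|[|[|i]]]] //; case: j => [|[|[|[|j]]]]. Qed.

Lemma cycle_dist4_even i j : i < 4 -> j < 4 -> i != j -> odd i = odd j ->
  cycle_dist 4 i j = 2.
Proof. by case: i => [|[|[|[|i]]]] //; case: j => [|[|[|[|j]]]]. Qed.

Section Squares.
Variables (T : finType) (R : realFieldType) (x : T -> R).
Hypothesis x_gt0 : forall u, (0 < x u)%R.
Implicit Types (S : nat -> nat -> nat) (b h : T -> nat).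

Definition star (q : T) (f : T -> nat) (u v : T) : nat :=
  if u == q then if v == q then 0 else f v else if v == q then f u else 0.

Lemma wsum_star q f : (wsum x (star q f)
  = (\sum_(v | v != q) (f v)%:R * (x v + x q) ^+ 2) *+ 2)%R.
Proof.
rewrite /wsum (bigD1 q) //= (bigD1 q) //= /star eqxx mul0r add0r mulr2n.
congr (_ + _)%R.
  by apply: eq_bigr => v /negbTE ->; rewrite (addrC (x q)).
apply: eq_bigr => u /negbTE uq.
rewrite (bigD1 q) //= uq eqxx big1 ?addr0 // => v /negbTE ->.
by rewrite mul0r.
Qed.

(* On the left, the distance from position [z] of the path [0, ..., m + r + 1]
   to a twin of position [m]; on the right, the distances to the extra vertex of
   the kite whose triangle is at [0] and at [m + r + 1] respectively. *)
Lemma square_kites_ineq m r z : 0 < m -> m <= r.+1 -> 2 < m + r ->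
    z <= (m + r).+1 ->
  (r + m) * (if z == m then 2 else adist z m) + (3 * (z == 0) + 2 * (z == m.+1))
  <= r * maxn z 1 + m * maxn ((m + r).+1 - z) 1 + (z == m).
Proof.
move=> m_gt0 mr mr3 zN.
have [->|z0] := eqVneq z 0.
  by rewrite eq_sym gtn_eqF //= /adist; nia.
have [->|zm] := eqVneq z m.
  have -> : (m == m.+1) = false by lia.
  have -> : maxn m 1 = m by lia.
  have -> : maxn ((m + r).+1 - m) 1 = r.+1 by lia.
  have [m' ?] : exists m', m = m'.+1 by exists m.-1; lia.
  have [r' ?] : exists r', r = r'.+1 by exists r.-1; lia.
  by subst m r; nia.
have -> : maxn z 1 = z by lia.
have [zlt|mlt] := ltnP z m.
  have -> : (z == m.+1) = false by lia.
  have -> : maxn ((m + r).+1 - z) 1 = (m + r).+1 - z by lia.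
  have -> : adist z m = m - z by rewrite /adist; lia.
  have [k ?] : exists k, m = z + k by exists (m - z); lia.
  subst m; have -> : (z + k + r).+1 - z = (k + r).+1 by lia.
  have -> : z + k - z = k by lia.
  by nia.
have [k ?] : exists k, z = m.+1 + k by exists (z - m.+1); lia.
subst z; have -> : adist (m.+1 + k) m = k.+1 by rewrite /adist; lia.
have [kr|rk] := ltnP k r; last first.
  have ? : k = r by lia.
  subst k; have -> : (m + r).+1 - (m.+1 + r) = 0 by lia.
  have -> : (m.+1 + r == m.+1) = false by lia.
  by nia.
have -> : maxn ((m + r).+1 - (m.+1 + k)) 1 = r - k by lia.
have [k0|k0] := posnP k.
  subst k; rewrite addn0 eqxx subn0.
  have [r' ?] : exists r', r = r'.+1 by exists r.-1; lia.
  by subst r; nia.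
have -> : (m.+1 + k == m.+1) = false by lia.
have [q ?] : exists q, r = k + q.+1 by exists (r - k.+1); lia.
subst r; have -> : k + q.+1 - k = q.+1 by lia.
by nia.
Qed.

(** Without [Q], the blocks [a], [p], [c] form a path with positions [z], and [Q] is a twin of [P],
    at position [m]. Two kites are averaged, with weights [r] and [m]: both keep this path and move
    [Q] into a triangle, at one end or at the other. *)
Lemma kite_of_square S sz b h (a p c q : nat) :
    path_blocks 4 sz b h ->
    (forall i, i < 4 -> [\/ i = a, i = p, i = c | i = q]) ->
    [/\ a < 4, p < 4, c < 4 & q < 4] -> uniq [:: a; p; c; q] ->
    sz p = 1 -> sz q = 1 -> sz a <= sz c ->
    (forall u v, b u = p -> b v = q -> x u <= x v)%R -> 5 < #|T| ->
    (forall i j, S i j = S j i) ->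
    [/\ S a p = 1, S p c = 1, S c q = 1 & S q a = 1] ->
    S a c = 2 -> S p q = 2 ->
  kite_like x (block_dist S b h).
Proof.
move=> [b_h inj_bh surj_bh sz_gt0] cover [a4 p4 c4 q4] uniq_l.
move=> szp szq sz_le x_le T6 SC [Sap Spc Scq Sqa] Sac Spq.
have [pa [ca [qa [cp [qp qc]]]]] : (p == a) = false /\ (c == a) = false /\
    (q == a) = false /\ (c == p) = false /\ (q == p) = false /\ (q == c) = false.
  by move: uniq_l; rewrite /= !inE; lia.
have [P bP _] := surj_bh p 0 p4 (sz_gt0 p p4).
have [Q bQ _] := surj_bh q 0 q4 (sz_gt0 q q4).
have Q1 u : (b u == q) = (u == Q).
  apply/eqP/eqP => [bu|-> //]; apply: inj_bh; first by rewrite bQ.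
  by have := (b_h u).2; have := (b_h Q).2; rewrite bu bQ szq; lia.
have P1 u : (b u == p) = (u == P).
  apply/eqP/eqP => [bu|-> //]; apply: inj_bh; first by rewrite bP.
  by have := (b_h u).2; have := (b_h P).2; rewrite bu bP szp; lia.
pose m := sz a; pose r := (sz c).-1.
have m_gt0 : 0 < m by exact: sz_gt0.
have szc : sz c = r.+1 by have := sz_gt0 c c4; rewrite /r; lia.
pose z u := if b u == a then m.-1 - h u else if b u == p then m
  else m.+1 + h u.
have zcase u : [\/ [/\ b u = a, h u < m & z u = m.-1 - h u],
    [/\ b u = p, h u = 0 & z u = m], [/\ b u = c, h u <= r & z u = m.+1 + h u]
    | u = Q].
  have [bu_lt] := b_h u; rewrite /z.
  case: (cover _ bu_lt) => bu; rewrite bu ?eqxx ?pa ?ca ?cp ?szp ?szc => lt_h.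
  - by constructor 1.
  - by constructor 2; split; lia.
  - by constructor 3.
  - by constructor 4; apply/eqP; rewrite -Q1 bu.
have z_le u : u != Q -> z u <= (m + r).+1.
  by case: (zcase u) => [[_ hu ->]|[_ _ ->]|[_ hu ->]|->]; rewrite ?eqxx //; lia.
have z_inj u v : u != Q -> v != Q -> z u = z v -> u = v.
  case: (zcase u) => [[bu hu ->]|[bu hu ->]|[bu hu ->]|->]; rewrite ?eqxx //;
  case: (zcase v) => [[bv hv ->]|[bv hv ->]|[bv hv ->]|->]; rewrite ?eqxx //;
  by move=> _ _ zuv; apply: inj_bh; lia.
have z_surj k : k <= (m + r).+1 -> exists2 u, u != Q & z u = k.
  move=> k_le; rewrite /z; have [km|mk] := ltnP k m.
    have [|u bu hu] := surj_bh a (m.-1 - k) a4; first by rewrite -/m; lia.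
    by exists u; rewrite -?Q1 bu ?eqxx ?(eq_sym a) ?qa //; lia.
  have [->|km] := eqVneq k m.
    by exists P; rewrite -?Q1 bP ?eqxx ?pa // eq_sym qp.
  have [|u bu hu] := surj_bh c (k - m.+1) c4; first by lia.
  by exists u; rewrite -?Q1 bu ?ca ?cp ?(eq_sym c) ?qc //; lia.
have T_card : (m + r).+3 = #|T|.
  pose w u := if u == Q then (m + r).+2 else z u.
  apply/eqP; rewrite eqn_leq; apply/andP; split.
    apply: (@surj_lt_card _ w) => k k_lt; rewrite /w.
    have [->|k_neq] := eqVneq k (m + r).+2; first by exists Q; rewrite eqxx.
    have [|u /negbTE uQ zu] := z_surj k; first by lia.
    by exists u; rewrite uQ.
  pose f u : 'I_(m + r).+3 := inord (w u).
  rewrite -[X in _ <= X]card_ord; apply: (@leq_card _ _ f) => u v.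
  have w_lt t : w t < (m + r).+3.
    by rewrite /w; case: eqP => // /eqP/z_le; lia.
  move=> /(congr1 val); rewrite /= !inordK // /w.
  case: eqP => [->|/eqP uQ]; case: eqP => [->|/eqP vQ] //.
  - by have := z_le v vQ; lia.
  - by have := z_le u uQ; lia.
  - exact: z_inj.
pose k0 u := if u == Q then 0 else (z u).+1.
pose k1 u := if u == Q then 0 else ((m + r).+1 - z u).+1.
have order_k0 : injective k0 /\ forall u, k0 u < #|T|.
  split=> [u v|u]; rewrite /k0.
    case: eqP => [->|/eqP uQ]; case: eqP => [->|/eqP vQ] // [].
    exact: z_inj.
  by rewrite -T_card; case: eqP => // /eqP/z_le; lia.
have order_k1 : injective k1 /\ forall u, k1 u < #|T|.
  split=> [u v|u]; rewrite /k1.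
    case: eqP => [->|/eqP uQ]; case: eqP => [->|/eqP vQ] // [] eq_z.
    by apply: z_inj => //; have := z_le u uQ; have := z_le v vQ; lia.
  by rewrite -T_card; case: eqP => // /eqP/z_le; lia.
suff [lt|lt] : (wsum x (block_dist S b h)
      < wsum x (fun u v => kite_dist (k0 u) (k0 v)))%R \/
    (wsum x (block_dist S b h)
      < wsum x (fun u v => kite_dist (k1 u) (k1 v)))%R.
- by exists k0; split; [exact: order_k0.1|exact: order_k0.2|left].
- by exists k1; split; [exact: order_k1.1|exact: order_k1.2|left].
have DQ u : u != Q -> block_dist S b h Q u = (if z u == m then 2 else adist (z u) m).
  have hQ : h Q = 0 by have := (b_h Q).2; rewrite bQ szq; lia.
  case: (zcase u) => [[bu hu ->]|[bu hu ->]|[bu hu ->]|->]; rewrite ?eqxx //;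
    rewrite /block_dist bQ bu ?qa ?qp ?qc hQ ?hu.
  - by rewrite Sqa ifF /adist; lia.
  - by rewrite (SC q) Spq.
  - by rewrite (SC q) Scq ifF /adist; lia.
have DZ u v : u != Q -> v != Q -> block_dist S b h u v = adist (z u) (z v).
  case: (zcase u) => [[bu hu ->]|[bu hu ->]|[bu hu ->]|->]; rewrite ?eqxx //;
  case: (zcase v) => [[bv hv ->]|[bv hv ->]|[bv hv ->]|->]; rewrite ?eqxx //;
  rewrite /block_dist bu bv ?eqxx ?pa ?ca ?cp ?(eq_sym a) ?(eq_sym p c)
    ?pa ?ca ?cp ?hu ?hv ?Sap ?Sac ?Spc ?(SC p a) ?(SC c) ?Sap ?Sac ?Spc /adist;
  by clear -hu hv m_gt0; lia.
have D_sym u v : block_dist S b h u v = block_dist S b h v u.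
  rewrite /block_dist eq_sym (SC (b u)); case: eqP => _; rewrite /adist; lia.
pose f u := 3 * (z u == 0) + 2 * (z u == m.+1).
pose f' u := nat_of_bool (z u == m).
have [u0 u0Q zu0] : exists2 u, u != Q & z u = 0 by apply: z_surj.
have [u1 u1Q zu1] : exists2 u, u != Q & z u = m.+1 by apply: z_surj; lia.
(* Only the pair of [P] and [Q] may lose, by 1, while [u0] and [u1] gain 3 and 2. As [x P <= x Q],
   the loss weighs at most [4 (x Q)^2] and the gain more than [5 (x Q)^2]. *)
have lt_star : (wsum x (star Q f') < wsum x (star Q f))%R.
  rewrite !wsum_star ltrMn2r /=.
  have PQ : P != Q by rewrite -Q1 bP eq_sym qp.
  have zP : z P = m by rewrite /z bP pa eqxx.
  rewrite (bigD1 P) //= {1}/f' zP eqxx big1 => [|v /andP[vQ vP]]; last first.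
    rewrite /f'; case: eqP => [zv|_]; last by rewrite mul0r.
    by case/eqP: vP; apply: z_inj; rewrite ?zP.
  rewrite (bigD1 u0) //= (bigD1 u1) /=; last first.
    by rewrite u1Q; apply/eqP => u10; move: zu1; rewrite u10 zu0.
  rewrite {1 2}/f zu0 zu1 !eqxx /=.
  have x_PQ := x_le P Q bP bQ.
  have rest : (0 <= \sum_(i | [&& i != Q, i != u0 & i != u1])
       (f i)%:R * (x i + x Q) ^+ 2)%R.
    by apply: sumr_ge0 => i _; rewrite mulr_ge0 ?sqr_ge0.
  rewrite (eq_bigl (fun i => [&& i != Q, i != u0 & i != u1])); last first.
    by move=> i; rewrite andbA.
  have := x_gt0 P; have := x_gt0 u0; have := x_gt0 u1; have := x_gt0 Q.
  by move: rest x_PQ; rewrite !mulnE /=; nra.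
apply: (mixture2 x_gt0 (a := r) (b := m) (E := star Q f) (E' := star Q f')).
- have mr : m <= r.+1 by rewrite -szc.
  (* Six vertices are used here: the vertex at position 0 gains exactly [m + r], which has to reach
     the 3 claimed in [f]. *)
  have mr3 : 2 < m + r by rewrite -T_card in T6.
  move=> u v; rewrite /star /k0 /k1.
  case: eqP => [->|/eqP uQ]; case: eqP => [->|/eqP vQ].
  + by rewrite /block_dist eqxx /adist subnn muln0.
  + rewrite DQ // !kite_dist0S; exact: square_kites_ineq (z_le v vQ).
  + rewrite D_sym DQ // !(kite_distC _.+1) !kite_dist0S.
    exact: square_kites_ineq (z_le u uQ).
  + rewrite DZ // !kite_distSS !addn0 mulnDl.
    suff -> : adist ((m + r).+1 - z u) ((m + r).+1 - z v) = adist (z u) (z v).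
      by [].
    by have := z_le u uQ; have := z_le v vQ; clear; rewrite /adist; lia.
- exact: ltW.
- by left.
Qed.

Lemma kite_of_4cycle sz b h : path_blocks 4 sz b h -> 5 < #|T| ->
  kite_like x (block_dist (cycle_dist 4) b h).
Proof.
move=> pb T6; pose S := cycle_dist 4.
have S_lip i j k : i < 4 -> j < 4 -> k < 4 -> odd j != odd k ->
    S i j <= (S i k).+1.
  by case: i => [|[|[|[|i]]]] //; case: j => [|[|[|[|j]]]] //;
    case: k => [|[|[|[|k]]]].
(* Adjacent blocks are merged until two opposite ones are single vertices. *)
have slide sz' b' h' i j o : path_blocks 4 sz' b' h' ->
    [/\ i < 4, j < 4 & o < 4] -> odd i != odd j -> i != o -> j != o ->
    exists sz2 b2 h2, [/\ path_blocks 4 sz2 b2 h2,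
      dominated x (block_dist S b' h') (block_dist S b2 h2),
      forall k, k != i -> k != j -> sz2 k = sz' k
      & sz2 i = 1 \/ sz2 j = 1].
  move=> pb' [i4 j4 o4] ij io jo.
  have neq_ij : i != j by apply: contraNneq ij => ->.
  rewrite eq_sym in io; rewrite eq_sym in jo.
  apply: (slide_edge x_gt0 pb' i4 j4 neq_ij o4 io jo (cycle_distC 4)).
    exact: cycle_dist4_odd.
  by move=> k k4 _ _; split; apply: S_lip => //; rewrite eq_sym.
have finish sz' b' h' a p c q : path_blocks 4 sz' b' h' ->
    [/\ a < 4, p < 4, c < 4 & q < 4] ->
    [/\ odd a = odd c, odd p = odd q & odd a != odd p] -> a != c -> p != q ->
    sz' p = 1 -> sz' q = 1 -> kite_like x (block_dist S b' h').
  move=> pb' [a4 p4 c4 q4] [ac pq ap] neq_ac neq_pq szp szq.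
  have single i w w' : sz' i = 1 -> b' w = i -> b' w' = i -> w = w'.
    have [b_h inj _ _] := pb' => szi bw bw'; apply: inj; rewrite ?bw ?bw' //.
    by have := (b_h w).2; have := (b_h w').2; rewrite bw bw' szi !ltnS !leqn0 =>
      /eqP-> /eqP->.
  have neq i j : odd i != odd j -> (i == j) = false.
    by move=> ij; apply: contraNF ij => /eqP->.
  (* The reflections of the square, exchanging [a] with [c] or [p] with [q], provide the two
     comparisons assumed in [kite_of_square]. *)
  wlog sz_le : a c a4 c4 ac ap neq_ac / sz' a <= sz' c.
    move=> wl; have [|/ltnW] := leqP (sz' a) (sz' c); first exact: wl.
    by apply: wl => //; rewrite -?ac // eq_sym.
  have [P bP _] : exists2 u, b' u = p & h' u = 0.
    by have [_ _ surj gt0] := pb'; apply: surj; rewrite ?szp.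
  have [Q bQ _] : exists2 u, b' u = q & h' u = 0.
    by have [_ _ surj gt0] := pb'; apply: surj; rewrite ?szq.
  wlog x_le : p q P Q bP bQ p4 q4 pq ap neq_pq szp szq / (x P <= x Q)%R.
    move=> wl; have [|/ltW] := lerP (x P) (x Q); first exact: (wl p q P Q).
    by apply: (wl q p Q P) => //; rewrite -?pq // eq_sym.
  have cover i : i < 4 -> [\/ i = a, i = p, i = c | i = q].
    move=> i4; have [->|ia] := eqVneq i a; first by constructor 1.
    have [->|ip] := eqVneq i p; first by constructor 2.
    have [->|ic] := eqVneq i c; first by constructor 3.
    have [->|iq] := eqVneq i q; first by constructor 4.
    have uniq5 : uniq [:: i; a; p; c; q].
      by rewrite /= !inE !negb_or ia ip ic iq neq_ac neq_pq !neq -?ac -?pq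
        // 1?eq_sym.
    have /allP lt4 : all (fun k => k < 4) [:: i; a; p; c; q].
      by rewrite /= i4 a4 p4 c4 q4.
    suff : 5 <= 4 by [].
    by apply: (uniq_leq_size uniq5 (s2 := iota 0 4)) => k /lt4; rewrite mem_iota.
  apply: (kite_of_square (a := a) (p := p) (c := c) (q := q) pb') => //.
  - by rewrite /= !inE !negb_or neq_ac neq_pq !neq -?ac -?pq // eq_sym.
  - by move=> u v bu bv; rewrite (single p u P) // (single q v Q).
  - exact: cycle_distC.
  - by split; apply: cycle_dist4_odd; rewrite // -?ac -?pq // eq_sym.
  - exact: cycle_dist4_even.
  - exact: cycle_dist4_even.
have finish13 sz' b' h' : path_blocks 4 sz' b' h' -> sz' 1 = 1 -> sz' 3 = 1 ->
    kite_like x (block_dist S b' h').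
  by move=> pb'; apply: (finish _ _ _ 0 1 2 3 pb').
have finish02 sz' b' h' : path_blocks 4 sz' b' h' -> sz' 0 = 1 -> sz' 2 = 1 ->
    kite_like x (block_dist S b' h').
  by move=> pb'; apply: (finish _ _ _ 1 0 3 2 pb').
have [//|//|//|//|sz1 [b1 [h1 [pb1 dom1 _ sz1E]]]] := slide sz b h 0 1 2 pb.
apply: kite_likeW dom1 _.
have [//|//|//|//|sz2 [b2 [h2 [pb2 dom2 sz2s sz2E]]]] := slide sz1 b1 h1 2 3 0 pb1.
apply: kite_likeW dom2 _.
have sz2_0 : sz2 0 = sz1 0 by apply: sz2s.
have sz2_1 : sz2 1 = sz1 1 by apply: sz2s.
(* If the two single vertices are adjacent on the square, one more slide between the two other
   blocks makes a third, opposite to one of them. *)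
case: sz1E sz2E => [sz10|sz11] [sz22|sz23].
- by apply: finish02 pb2 _ _; rewrite ?sz2_0.
- have [//|//|//|//|sz3 [b3 [h3 [pb3 dom3 sz3s sz3E]]]] := slide sz2 b2 h2 1 2 0 pb2.
  apply: kite_likeW dom3 _.
  have e0 : sz3 0 = 1 by rewrite sz3s // sz2_0.
  have e3 : sz3 3 = 1 by rewrite sz3s.
  by case: sz3E => e; [apply: finish13 pb3 _ _|apply: finish02 pb3 _ _].
- have [//|//|//|//|sz3 [b3 [h3 [pb3 dom3 sz3s sz3E]]]] := slide sz2 b2 h2 3 0 1 pb2.
  apply: kite_likeW dom3 _.
  have e1 : sz3 1 = 1 by rewrite sz3s // sz2_1.
  have e2 : sz3 2 = 1 by rewrite sz3s.
  by case: sz3E => e; [apply: finish13 pb3 _ _|apply: finish02 pb3 _ _].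
- by apply: finish13 pb2 _ _; rewrite ?sz2_1.
Qed.

End Squares.

(** * Longer cycles *)

(* Position of [i] when the cycle [0, ..., g - 1] is read from [k], in one of
   the two directions. *)
Definition cycle_pos (g : nat) (dir : bool) (k i : nat) : nat :=
  if dir then (if k <= i then i - k else i + g - k)
  else (if i <= k then k - i else k + g - i).

(* The cycle is cut open just before [k] in the given direction, and [k] is
   joined to the second next point: this creates the triangle of a kite. *)
Definition cut_dist (g : nat) (dir : bool) (k i j : nat) : nat :=
  kite_dist (cycle_pos g dir k i) (cycle_pos g dir k j).

Definition cut_dist2 g k i j := cut_dist g true k i j + cut_dist g false k i j.

Lemma cut_distC g dir k a b : cut_dist g dir k a b = cut_dist g dir k b a.
Proof. exact: kite_distC. Qed.

Section Cuts.
Variables (g i j : nat).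
Hypotheses (g_gt2 : 2 < g) (ig : i < g) (jg : j < g) (ij : i != j).
Let s := cycle_dist g i j.

(** The chord of the kite shortens only distances from [k] itself; between other points, opening the
    cycle cannot shorten anything. *)
Lemma cut_dist_other dir k : k < g -> k != i -> k != j ->
  s <= cut_dist g dir k i j.
Proof.
move=> kg ki kj; rewrite /cut_dist.
have [pi pj] : 0 < cycle_pos g dir k i /\ 0 < cycle_pos g dir k j.
  rewrite /cycle_pos; case: (dir).
    by case: (leqP k i); case: (leqP k j); lia.
  by case: (leqP i k); case: (leqP j k); lia.
rewrite /kite_dist (gtn_eqF pi) (gtn_eqF pj) subn0.
rewrite /s /cycle_dist /cycle_pos /adist; case: (dir).
  by case: (leqP k i); case: (leqP k j); lia.
by case: (leqP i k); case: (leqP j k); lia.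
Qed.

Lemma cut_dist2_other k : k < g -> k != i -> k != j ->
  2 * s <= cut_dist2 g k i j.
Proof.
move=> kg ki kj; rewrite /cut_dist2 mul2n -addnn.
by rewrite leq_add // cut_dist_other.
Qed.

Lemma cycle_pos_left : exists2 r, 0 < r < g &
  [/\ cycle_pos g true i j = r, cycle_pos g false i j = g - r
    & s = minn r (g - r)].
Proof.
rewrite /cycle_pos /s /cycle_dist /adist; have [lt_ij|le_ji] := ltnP i j.
  by exists (j - i); [lia|rewrite (ltnW lt_ij) /=; split; lia].
have lt_ji : j < i by lia.
by exists (j + g - i); [lia|rewrite (leqNgt i j) lt_ji /=; split; lia].
Qed.

(** The positions of [j] in the two directions add up to [g], and the chord takes 1 off each
    position beyond 1: both if [s > 1], only one if [s = 1]. *)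
Lemma cut_dist2_left : cut_dist2 g i i j + 1 + (1 < s) = g.
Proof.
have [r r_lt [pos_t pos_f ->]] := cycle_pos_left.
have pos0 dir : cycle_pos g dir i i = 0.
  by rewrite /cycle_pos leqnn subnn; case: dir.
rewrite /cut_dist2 /cut_dist !pos0 pos_t pos_f !kite_dist0; lia.
Qed.

Lemma cycle_pos_next : 1 < s -> exists2 k,
  [/\ k < g, k != i, k != j & cycle_dist g k i + cycle_dist g k j = s] &
  exists dir, [/\ cycle_pos g dir k j = s.-1, cycle_pos g dir k i = g.-1,
    cycle_pos g (~~ dir) k i = 1 & cycle_pos g (~~ dir) k j = (g - s).+1].
Proof.
move=> s_gt1; have [r r_lt [pos_t pos_f s_r]] := cycle_pos_left.
have [sr|sr] : s = r \/ s = g - r by rewrite s_r; lia.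
- pose k := if i.+1 == g then 0 else i.+1.
  have kE : k = if i.+1 == g then 0 else i.+1 by [].
  have [ke|ke] : i.+1 = g /\ k = 0 \/ i.+1 < g /\ k = i.+1.
    by rewrite kE; case: eqP; lia.
  + exists k; first by move: pos_t s_gt1;
      rewrite sr /cycle_dist /cycle_pos /adist; case: ifP; split; lia.
    exists true; move: pos_t; rewrite /cycle_pos /= ke.2.
    by do ?match goal with |- context[if ?b then _ else _] => case: (boolP b) => ? end;
      split; lia.
  + exists k; first by move: pos_t s_gt1;
      rewrite sr /cycle_dist /cycle_pos /adist; case: ifP; split; lia.
    exists true; move: pos_t; rewrite /cycle_pos /= ke.2.
    by do ?match goal with |- context[if ?b then _ else _] => case: (boolP b) => ? end;
      split; lia.
- pose k := if i == 0 then g.-1 else i.-1.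
  have kE : k = if i == 0 then g.-1 else i.-1 by [].
  have [ke|ke] : i = 0 /\ k = g.-1 \/ 0 < i /\ k = i.-1.
    by rewrite kE; case: eqP; lia.
  + exists k; first by move: pos_t s_gt1;
      rewrite sr /cycle_dist /cycle_pos /adist; case: ifP; split; lia.
    exists false; move: pos_t; rewrite /cycle_pos /= ke.2.
    by do ?match goal with |- context[if ?b then _ else _] => case: (boolP b) => ? end;
      split; lia.
  + exists k; first by move: pos_t s_gt1;
      rewrite sr /cycle_dist /cycle_pos /adist; case: ifP; split; lia.
    exists false; move: pos_t; rewrite /cycle_pos /= ke.2.
    by do ?match goal with |- context[if ?b then _ else _] => case: (boolP b) => ? end;
      split; lia.
Qed.

(** Here [k] is the neighbour of [i] on a shortest arc to [j]. Both cuts at [k] break this arc, one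
    on each side of [k], so only the long way of length [g - s] is left. *)
Lemma cut_dist2_inside : 1 < s -> exists k, [/\ k < g, k != i, k != j,
  cycle_dist g k i + cycle_dist g k j = s & 2 * (g - s) <= cut_dist2 g k i j].
Proof.
move=> s_gt1; have [k [kg ki kj ks] [dir [e1 e2 e3 e4]]] := cycle_pos_next s_gt1.
exists k; split=> //.
have -> : cut_dist2 g k i j = cut_dist g dir k i j + cut_dist g (~~ dir) k i j.
  by rewrite /cut_dist2; case: (dir) => //=; rewrite addnC.
have s_le : s <= g by rewrite /s /cycle_dist; lia.
rewrite /cut_dist e1 e2 e3 e4 /kite_dist /adist; lia.
Qed.
End Cuts.


Lemma cut_dist2_right g i j : 2 < g -> i < g -> j < g -> i != j ->
  cut_dist2 g j i j + 1 + (1 < cycle_dist g i j) = g.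
Proof.
move=> g_gt2 ig jg ij; have := @cut_dist2_left g j i g_gt2 jg ig.
by rewrite eq_sym cycle_distC /cut_dist2 !(cut_distC _ _ _ i) => ->.
Qed.

Lemma sum_ge_at (g c : nat) (G : nat -> nat) (pts : seq nat) :
    uniq pts -> all (fun k => k < g) pts ->
    (forall k, k < g -> k \notin pts -> c <= G k) ->
  \sum_(k <- pts) G k + (g - size pts) * c <= \sum_(k < g) G k.
Proof.
move=> pts_uniq /allP pts_lt leG.
rewrite -(big_mkord xpredT G) /index_iota subn0.
rewrite [X in _ <= X](bigID (mem pts)) /=.
have perm_pts : perm_eq [seq k <- iota 0 g | k \in pts] pts.
  apply: uniq_perm => // [|k]; first by rewrite filter_uniq ?iota_uniq.
  rewrite mem_filter mem_iota /= add0n; case: (boolP (k \in pts)) => //=.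
  by move/pts_lt.
rewrite -[X in _ <= X + _]big_filter.
have -> : \sum_(k <- [seq k <- iota 0 g | k \in pts]) G k = \sum_(k <- pts) G k.
  exact: perm_big.
rewrite leq_add2l -big_filter.
have -> : g - size pts = size [seq k <- iota 0 g | k \notin pts].
  have := count_predC (mem pts) (iota 0 g).
  have -> : count (mem pts) (iota 0 g) = size pts.
    by rewrite -size_filter; exact: perm_size.
  by rewrite size_iota size_filter => eq_g; rewrite -{1}eq_g addKn.
have : forall k, k \in [seq k <- iota 0 g | k \notin pts] -> c <= G k.
  by move=> k; rewrite mem_filter mem_iota => /and3P[kpts _ kg]; exact: leG.
elim: [seq _ <- _ | _] => [|k l IHl] le_l; first by rewrite big_nil.
rewrite big_cons /= mulSn leq_add ?le_l ?mem_head // IHl // => k' k'l.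
by rewrite le_l // inE k'l orbT.
Qed.

(** For [s > 1], compared with [2 s] for each [k], the cuts at [i], at [j] and just inside the
    shorter arc have a total excess of at least [4 (g - 1 - 2 s)]. It is nonnegative because
    [2 s < g] for odd [g]; opposite points of an even cycle would give -4. *)
Lemma odd_cut_sum g i j (s := cycle_dist g i j) : odd g -> 4 < g -> i < g -> j < g -> i != j ->
  2 * g * s + (s == 1) <= \sum_(k < g) cut_dist2 g k i j.
Proof.
move=> g_odd g4 ig jg ij.
have s_le : 2 * s < g by rewrite /s /cycle_dist /adist; lia.
have s_gt0 : 0 < s by rewrite /s /cycle_dist /adist; lia.
have g_gt2 : 2 < g by lia.
have Gi := cut_dist2_left g_gt2 ig jg ij.
have Gj := cut_dist2_right g_gt2 ig jg ij.
have Gk := @cut_dist2_other g i j g_gt2 ig jg ij.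
rewrite -/s in Gi Gj Gk.
have [s_gt1|s_le1] := ltnP 1 s; last first.
  have le_sum := @sum_ge_at g (2 * s) (fun k => cut_dist2 g k i j) [:: i; j].
  rewrite /= !inE ij ig jg in le_sum.
  apply: leq_trans (le_sum isT isT _) => [|k kg]; last first.
    by rewrite !inE negb_or => /andP[ki kj]; exact: Gk.
  rewrite !big_cons big_nil; have -> : s = 1 by lia.
  by rewrite (_ : (1 < s) = false) in Gi Gj; lia.
have [k0 [k0g k0i k0j _ Gk0]] := cut_dist2_inside g_gt2 ig jg ij s_gt1.
have le_sum := @sum_ge_at g (2 * s) (fun k => cut_dist2 g k i j) [:: i; j; k0].
rewrite /= !inE negb_or ij (eq_sym i k0) (eq_sym j k0) k0i k0j ig jg k0g in le_sum.
apply: leq_trans (le_sum isT isT _) => [|k kg]; last first.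
  by rewrite !inE !negb_or => /and3P[ki kj _]; exact: Gk.
rewrite !big_cons big_nil; rewrite s_gt1 in Gi Gj; rewrite -/s in Gk0.
have [t ?] : exists t, g = s.*2 + t.+1 by exists (g - s.*2).-1; lia.
have -> : (s == 1) = false by lia.
by clearbody s; subst g; nia.
Qed.

(** The cuts at [K] and [K'] are omitted. Opposite points outside [{K, K'}] lose at most 4, since
    the cuts at [i] and at [j] each give [g - 2] instead of [2 m]. A pair with just one end in
    [{K, K'}] and [s < m] gains: for [s > 1], the cut inside its shorter arc brings
    [2 (g - 2 s) >= 4]; for [s = 1], the cut at its other end brings [g - 3], which is at least 3
    when [m > 2]. *)
Lemma even_cut_sum g m K K' i j (s := cycle_dist g i j)
    (q := fun k => (k == K) || (k == K')) : g = m.*2 -> 2 < m -> K < g -> K' < g ->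
    adist K K' = m -> i < g -> j < g -> i != j ->
  2 * (g - 2) * s + 2 * (q i (+) q j) + ((q i (+) q j) && (s == 1))
  <= \sum_(k < g) ~~ q k * cut_dist2 g k i j
     + 4 * (~~ q i && (adist i j == m)).
Proof.
move=> gm m2 Kg K'g KK' ig jg ij.
have KK'_neq : K != K' by move: KK'; rewrite /adist; lia.
have s_le : s <= m by rewrite /s /cycle_dist /adist; lia.
have s_gt0 : 0 < s by rewrite /s /cycle_dist /adist; lia.
have g_gt2 : 2 < g by lia.
have [exp2 exp3 exp4] : [/\ 2 * (g - 2) * s = (g - 2) * (2 * s),
    2 * (g - 2) * s = (g - 3) * (2 * s) + 2 * s
  & 2 * (g - 2) * s = (g - 4) * (2 * s) + 4 * s].
  have [t ->] : exists t, g = t + 4 by exists (g - 4); lia.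
  have -> : t + 4 - 2 = t + 2 by lia.
  have -> : t + 4 - 3 = t + 1 by lia.
  by rewrite addnK; clearbody s; split; ring.
have Gi := cut_dist2_left g_gt2 ig jg ij.
have Gj := cut_dist2_right g_gt2 ig jg ij.
have Gk := @cut_dist2_other g i j g_gt2 ig jg ij.
rewrite -/s in Gi Gj Gk.
pose G k := ~~ q k * cut_dist2 g k i j.
have GK : G K = 0 by rewrite /G /q eqxx.
have GK' : G K' = 0 by rewrite /G /q eqxx orbT.
have Gq k : ~~ q k -> G k = cut_dist2 g k i j by rewrite /G => ->; rewrite mul1n.
have sum_ge pts : uniq pts -> all (fun k => k < g) pts -> K \in pts ->
    K' \in pts -> (~~ q i -> i \in pts) -> (~~ q j -> j \in pts) ->
    \sum_(k <- pts) G k + (g - size pts) * (2 * s) <= \sum_(k < g) G k.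
  move=> pts_uniq pts_lt Kp K'p ip jp; apply: sum_ge_at => // k kg kp.
  have qk : ~~ q k.
    by apply: contra kp; rewrite /q => /orP[] /eqP->.
  rewrite Gq //; apply: Gk => //.
    by apply: contraNneq kp => ki; rewrite ki; apply: ip; rewrite -ki.
  by apply: contraNneq kp => kj; rewrite kj; apply: jp; rewrite -kj.
rewrite -/(\sum_(k < g) G k).
have qP k : q k = (k == K) || (k == K') by [].
have qE k : q k = false -> k != K /\ k != K' by rewrite qP => /norP.
have distK : cycle_dist g K K' = m by rewrite /cycle_dist KK' gm; lia.
(* The cut inside the shorter arc must not be an omitted one: it is too close to one of [K], [K'] to
   be the other. *)
have far a k : q a -> k != a -> cycle_dist g k a < m -> k != K /\ k != K'.
  rewrite qP => /orP[] /eqP -> ka lt; split=> //; apply: contraTneq lt => ->;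
    by rewrite ?(cycle_distC g K' K) distK ltnn.
clearbody q.
case qi: (q i); case qj: (q j) => /=.
- apply: leq_trans (leq_addr _ _); apply: leq_trans (sum_ge [:: K; K'] _ _ _ _ _ _);
    rewrite /= ?inE ?eqxx ?orbT ?KK'_neq ?Kg ?K'g ?qi ?qj //.
  by rewrite !big_cons big_nil GK GK' exp2; lia.
- have [jK jK'] := qE j qj.
  have s_lt : s < m.
    by move: KK' qi jK jK'; rewrite qP /s /cycle_dist /adist; lia.
  have [s_gt1|s_le1] := ltnP 1 s; last first.
    apply: leq_trans (leq_addr _ _); apply: leq_trans (sum_ge [:: j; K; K'] _ _ _ _ _ _);
      rewrite /= ?inE ?eqxx ?orbT ?negb_or ?jK ?jK' ?KK'_neq ?Kg ?K'g ?jg ?qi ?qj //.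
    rewrite !big_cons big_nil GK GK' (Gq j) ?qj // exp3; lia.
  have [k0 [k0g k0i k0j k0s Gk0]] := cut_dist2_inside g_gt2 ig jg ij s_gt1.
  have [k0K k0K'] : k0 != K /\ k0 != K'.
    by apply: (far i) => //; rewrite ?qi //; clear -k0s s_lt; lia.
  apply: leq_trans (leq_addr _ _); apply: leq_trans (sum_ge [:: k0; j; K; K'] _ _ _ _ _ _);
    rewrite /= ?inE ?eqxx ?orbT ?negb_or ?k0j ?k0K ?k0K' ?jK ?jK' ?KK'_neq ?Kg ?K'g ?jg ?k0g ?qi ?qj //.
  have qk0 : ~~ q k0 by rewrite qP negb_or k0K.
  rewrite !big_cons big_nil GK GK' (Gq j) ?qj // (Gq k0) //.
  rewrite s_gt1 in Gi Gj; rewrite -/s in Gk0.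
  by rewrite /= exp4; lia.
- have [iK iK'] := qE i qi.
  have s_lt : s < m.
    by move: KK' qj iK iK'; rewrite qP /s /cycle_dist /adist; lia.
  have [s_gt1|s_le1] := ltnP 1 s; last first.
    apply: leq_trans (leq_addr _ _); apply: leq_trans (sum_ge [:: i; K; K'] _ _ _ _ _ _);
      rewrite /= ?inE ?eqxx ?orbT ?negb_or ?iK ?iK' ?KK'_neq ?Kg ?K'g ?ig ?qi ?qj //.
    rewrite !big_cons big_nil GK GK' (Gq i) ?qi // exp3; lia.
  have [k0 [k0g k0i k0j k0s Gk0]] := cut_dist2_inside g_gt2 ig jg ij s_gt1.
  have [k0K k0K'] : k0 != K /\ k0 != K'.
    by apply: (far j) => //; rewrite ?qj //; clear -k0s s_lt; lia.
  apply: leq_trans (leq_addr _ _); apply: leq_trans (sum_ge [:: k0; i; K; K'] _ _ _ _ _ _);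
    rewrite /= ?inE ?eqxx ?orbT ?negb_or ?k0i ?k0K ?k0K' ?iK ?iK' ?KK'_neq ?Kg ?K'g ?ig ?k0g ?qi ?qj //.
  have qk0 : ~~ q k0 by rewrite qP negb_or k0K.
  rewrite !big_cons big_nil GK GK' (Gq i) ?qi // (Gq k0) //.
  rewrite s_gt1 in Gi Gj; rewrite -/s in Gk0.
  by rewrite /= exp4; lia.
- have [iK iK'] := qE i qi; have [jK jK'] := qE j qj.
  have ge4 : \sum_(k <- [:: i; j; K; K']) G k + (g - 4) * (2 * s)
      <= \sum_(k < g) G k.
    apply: sum_ge; rewrite /= ?inE ?eqxx ?orbT ?negb_or ?ij ?iK ?iK' ?jK ?jK'
      ?KK'_neq ?Kg ?K'g ?ig ?jg //.
  move: ge4; rewrite !big_cons big_nil GK GK' (Gq i) ?qi // (Gq j) ?qj //.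
  have sm : (s == m) = (adist i j == m).
    have : adist i j < g by rewrite /adist; lia.
    by rewrite /s /cycle_dist gm; clear; lia.
  rewrite -sm exp4 /=; lia.
Qed.

(** * Weights between blocks of vertices *)

Section BlockWeights.
Local Open Scope ring_scope.
Variables (T : finType) (R : realFieldType) (x : T -> R).
Hypothesis x_gt0 : forall u, 0 < x u.
Implicit Types A B C D : pred T.

Definition weight A B : R := \sum_(u | A u) \sum_(v | B v) (x u + x v) ^+ 2.

Let cnt A : R := \sum_(u | A u) 1.
Let sq A : R := \sum_(u | A u) x u ^+ 2.
Let tot A : R := \sum_(u | A u) x u.

Let cnt_ge0 A : 0 <= cnt A. Proof. exact: sumr_ge0. Qed.
Let sq_ge0 A : 0 <= sq A. Proof. by apply: sumr_ge0 => u _; rewrite sqr_ge0. Qed.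
Let tot_ge0 A : 0 <= tot A. Proof. by apply: sumr_ge0 => u _; rewrite ltW. Qed.

Let double_sumE A B (a b c : R) :
  \sum_(u | A u) \sum_(v | B v) (a * x u ^+ 2 + b * (x u * x v) + c * x v ^+ 2)
  = a * sq A * cnt B + b * (tot A * tot B) + c * cnt A * sq B.
Proof.
transitivity (\sum_(u | A u) (a * x u ^+ 2 * cnt B + b * (x u * tot B) + c * sq B)).
  apply: eq_bigr => u _; rewrite !big_split /=.
  rewrite -[X in X + _ + _]mulr_sumr -!mulr_sumr; congr (_ + _ + _).
  by rewrite /cnt !mulr_sumr; apply: eq_bigr => v _; rewrite mulr1.
rewrite !big_split /=; congr (_ + _ + _).
- by rewrite -mulr_suml -mulr_sumr.
- by rewrite -mulr_sumr -mulr_suml.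
- rewrite /cnt -mulrA mulr_suml mulr_sumr.
  by apply: eq_bigr => v _; rewrite mul1r.
Qed.

Let weightE A B : weight A B = sq A * cnt B + 2 * (tot A * tot B) + cnt A * sq B.
Proof.
transitivity (1 * sq A * cnt B + 2 * (tot A * tot B) + 1 * cnt A * sq B).
  rewrite -double_sumE /weight; apply: eq_bigr => u _; apply: eq_bigr => v _.
  by ring.
by rewrite !mul1r.
Qed.

Let cauchy A : tot A ^+ 2 <= cnt A * sq A.
Proof.
have : 0 <= \sum_(u | A u) \sum_(v | A v) (x u - x v) ^+ 2.
  by apply: sumr_ge0 => u _; apply: sumr_ge0 => v _; rewrite sqr_ge0.
have -> : \sum_(u | A u) \sum_(v | A v) (x u - x v) ^+ 2
    = 1 * sq A * cnt A + (- 2) * (tot A * tot A) + 1 * cnt A * sq A.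
  rewrite -double_sumE; apply: eq_bigr => u _; apply: eq_bigr => v _.
  by ring.
by move: (cnt A) (sq A) (tot A) => n s t; nra.
Qed.

Lemma weightC A B : weight A B = weight B A.
Proof. by rewrite !weightE; ring. Qed.

(** The mixed term is at most [tot A ^ 2 + tot B ^ 2], and Cauchy-Schwarz inside each block bounds
    these squares by the two diagonal products on the right. *)
Let weight_union A B : weight A B <= (cnt A + cnt B) * (sq A + sq B).
Proof.
rewrite weightE; have := cauchy A; have := cauchy B.
have := sqr_ge0 (tot A - tot B).
by move: (cnt A) (sq A) (tot A) (cnt B) (sq B) (tot B) => ??????; nra.
Qed.

(* A Ptolemy-type inequality: the weight between two unions dominates the
   geometric mean of the weights inside the unions. *)
Lemma weight_ptolemy A B C D t : t <= weight A B -> t <= weight C D ->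
  t *+ 2 <= weight A C + weight A D + weight B C + weight B D.
Proof.
move=> tAB tCD; have [t_lt0|t_ge0] := ltP t 0.
  apply: le_trans (_ : 0 <= _); first by rewrite mulrn_wle0 // ltW.
  have w_ge0 A' B' : 0 <= weight A' B'.
    by apply: sumr_ge0 => u _; apply: sumr_ge0 => v _; rewrite sqr_ge0.
  by rewrite !addr_ge0.
pose n1 := cnt A + cnt B; pose s1 := sq A + sq B.
pose n2 := cnt C + cnt D; pose s2 := sq C + sq D.
have t1 : t <= n1 * s1 by apply: le_trans tAB (weight_union A B).
have t2 : t <= n2 * s2 by apply: le_trans tCD (weight_union C D).
have [n1_ge0 s1_ge0] : 0 <= n1 /\ 0 <= s1 by rewrite !addr_ge0.
have [n2_ge0 s2_ge0] : 0 <= n2 /\ 0 <= s2 by rewrite !addr_ge0.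
(* The products [n1 s2] and [s1 n2] have the same geometric mean as [n1 s1] and [n2 s2], so their
   sum is at least [2 t]. The four weights add only nonnegative products of totals to it. *)
apply: (@le_trans _ _ (n1 * s2 + s1 * n2)).
  rewrite -(@ler_pXn2r _ 2) ?nnegrE ?mulrn_wge0 ?addr_ge0 ?mulr_ge0 //.
  have t12 : t ^+ 2 <= (n1 * s1) * (n2 * s2) by rewrite expr2 ler_pM.
  have := sqr_ge0 (n1 * s2 - s1 * n2).
  by move: t12; move: n1 n2 s1 s2 {t1 t2 n1_ge0 n2_ge0 s1_ge0 s2_ge0} => ????; nra.
rewrite /n1 /n2 /s1 /s2 !weightE.
have := mulr_ge0 (tot_ge0 A) (tot_ge0 C); have := mulr_ge0 (tot_ge0 A) (tot_ge0 D).
have := mulr_ge0 (tot_ge0 B) (tot_ge0 C); have := mulr_ge0 (tot_ge0 B) (tot_ge0 D).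
by lra.
Qed.

Variables (g : nat) (b : T -> 'I_g).
Let W (i j : 'I_g) := weight (fun u => b u == i) (fun u => b u == j).

Lemma wsum_blocks (f : 'I_g -> 'I_g -> nat) :
  wsum x (fun u v => f (b u) (b v)) = \sum_i \sum_j (f i j)%:R * W i j.
Proof.
rewrite /wsum (partition_big b xpredT) //=; apply: eq_bigr => i _.
transitivity (\sum_(u | b u == i) \sum_j \sum_(v | b v == j)
    (f i j)%:R * (x u + x v) ^+ 2).
  apply: eq_bigr => u /eqP bu; rewrite (partition_big b xpredT) //=.
  by apply: eq_bigr => j _; apply: eq_bigr => v /eqP bv; rewrite bu bv.
rewrite exchange_big; apply: eq_bigr => j _.
rewrite /W /weight mulr_sumr; apply: eq_bigr => u _.
by rewrite mulr_sumr.
Qed.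

(* The pair [K, op K] of opposite blocks of maximal weight is heavy enough to
   compensate for all the other pairs of opposite blocks. *)
Lemma opposite_blocks (op : 'I_g -> 'I_g) (K : 'I_g)
    (q := fun i => (i == K) || (i == op K)) :
    involutive op -> op K != K -> (forall i, W i (op i) <= W K (op K)) ->
  wsum x (fun u v => 4 * (~~ q (b u) && (b v == op (b u))))%N
  <= wsum x (fun u v => 2 * (q (b u) (+) q (b v)))%N.
Proof.
move=> opK opK_neq W_max.
have q_op i : q (op i) = q i.
  by rewrite /q (inj_eq (inv_inj opK)) -{1}[K]opK (inj_eq (inv_inj opK)) orbC.
have sumK (F : 'I_g -> R) : \sum_(j | q j) F j = F K + F (op K).
  rewrite (bigD1 K) /=; last by rewrite /q eqxx.
  rewrite (bigD1 (op K)) /=; last by rewrite /q eqxx orbT opK_neq.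
  rewrite big1 ?addr0 // => j /andP[/andP[]].
  by rewrite /q => /orP[] -> //=.
rewrite (wsum_blocks (fun i j => 4 * (~~ q i && (j == op i)))%N).
rewrite (wsum_blocks (fun i j => 2 * (q i (+) q j))%N).
have -> : \sum_i \sum_j (4 * (~~ q i && (j == op i)))%N%:R * W i j
    = 4 * \sum_(i | ~~ q i) W i (op i).
  rewrite [X in _ = _ * X]big_mkcond mulr_sumr; apply: eq_bigr => i _.
  rewrite (bigD1 (op i)) //= eqxx andbT big1 ?addr0 => [|j /negbTE ->].
    by case: (q i) => /=; rewrite ?muln0 ?muln1 ?mul0r ?mulr0.
  by rewrite andbF muln0 mul0r.
have -> : \sum_i \sum_j (2 * (q i (+) q j))%N%:R * W i j
    = 4 * \sum_(i | ~~ q i) (W i K + W i (op K)).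
  transitivity (2 * (\sum_(i | ~~ q i) \sum_(j | q j) W i j)
                + 2 * (\sum_(i | q i) \sum_(j | ~~ q j) W i j)).
    rewrite (bigID (fun i => ~~ q i)) /= !mulr_sumr; congr (_ + _).
      apply: eq_bigr => i /negbTE qi; rewrite mulr_sumr [RHS]big_mkcond.
      by apply: eq_bigr => j _; rewrite qi; case: (q j); rewrite ?muln0 ?mul0r.
    under eq_bigl do rewrite negbK.
    apply: eq_bigr => i qi; rewrite mulr_sumr [RHS]big_mkcond.
    by apply: eq_bigr => j _; rewrite qi; case: (q j); rewrite ?muln0 ?mul0r.
  have -> : \sum_(i | q i) \sum_(j | ~~ q j) W i j
      = \sum_(i | ~~ q i) \sum_(j | q j) W i j.
    rewrite exchange_big; apply: eq_bigr => i _; apply: eq_bigr => j _.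
    exact: weightC.
  rewrite -mulrDl; congr (_ * _); first by ring.
  by apply: eq_bigr => i _; rewrite sumK.
rewrite ler_pM2l // -(@ler_pMn2r _ 2) //.
(* Doubling and reindexing one copy by [op] joins each block to its opposite, which gives the four
   weights of [weight_ptolemy]. *)
have -> : (\sum_(i | ~~ q i) (W i K + W i (op K))) *+ 2
    = \sum_(i | ~~ q i) (W i K + W i (op K) + W (op i) K + W (op i) (op K)).
  rewrite mulr2n [X in _ + X](reindex_inj (inv_inj opK)) /=.
  under [X in _ + X]eq_bigl do rewrite q_op.
  by rewrite -big_split; apply: eq_bigr => i _; rewrite /= !addrA.
rewrite -sumrMnl; apply: ler_sum => i _.
by apply: weight_ptolemy => //; exact: W_max.
Qed.

End BlockWeights.

(** * Averages of cuts for cycles of length at least five *)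

Section LongCycles.
Variables (T : finType) (R : realFieldType) (x : T -> R).
Hypothesis x_gt0 : forall u, (0 < x u)%R.
Implicit Types (b h : T -> nat).

Lemma kite_dist_triangle i j k :
  kite_dist i k <= kite_dist i j + kite_dist j k.
Proof.
case: i => [|i]; case: j => [|j]; case: k => [|k];
  rewrite ?(kite_distC _.+1 0) ?kite_dist0S ?kite_distSS //; rewrite /adist; lia.
Qed.

(** A cut cycle still carries its hanging paths. Its distance function is a metric, the pairs at
    distance at most 1 connect all vertices, and the points 0, 1, 2 of the skeleton form a triangle,
    so the case of a triangle with hanging trees applies again. *)
Lemma kite_of_skeleton g b h : 2 < g ->
    (forall u, b u < g) -> (forall i, i < g -> exists2 u, b u = i & h u = 0) ->
    (forall u k, h u = k.+1 -> exists2 v, b v = b u & h v = k) ->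
  kite_like x (block_dist kite_dist b h).
Proof.
move=> g_gt2 b_lt b_surj h_pred; pose d := block_dist kite_dist b h.
have d0 u : d u u = 0 by rewrite /d /block_dist eqxx /adist; lia.
have dC u v : d u v = d v u.
  by rewrite /d /block_dist eq_sym (kite_distC (b u)) /adist; case: eqP => _; lia.
have dD u v z : d u z <= d u v + d v z.
  rewrite /d /block_dist; have := kite_dist_triangle (b u) (b v) (b z).
  case: (eqVneq (b u) (b v)) => [->|uv].
    by case: (eqVneq (b v) (b z)) => [->|vz]; rewrite /adist; lia.
  case: (eqVneq (b v) (b z)) => [<-|vz]; first by rewrite (negbTE uv) /adist; lia.
  by case: (eqVneq (b u) (b z)) => [<-|uz]; rewrite /adist; lia.
pose e : rel T := fun u v => d u v <= 1.
have eC : connect_sym e.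
  by apply: sym_connect_sym => u v; rewrite /e dC.
have [r br hr] := b_surj 0 (ltnW (ltnW g_gt2)).
have conn0 i u : b u = i -> h u = 0 -> connect e u r.
  elim: i u => [|i IHi] u bu hu.
    by apply: connect1; rewrite /e /d /block_dist bu br hu hr.
  have [|v bv hv] := b_surj i; first by have := b_lt u; lia.
  apply: connect_trans (IHi v bv hv); apply: connect1.
  rewrite /e /d /block_dist bu bv hu hv ifF /kite_dist /adist; lia.
have conn_r k u : h u = k -> connect e u r.
  elim: k u => [|k IHk] u hu; first exact: conn0 hu.
  have [v bv hv] := h_pred u k hu.
  apply: connect_trans (IHk v hv); apply: connect1.
  by rewrite /e /d /block_dist bv eqxx hu hv /adist; lia.
have e_conn u v : connect e u v.
  by apply: connect_trans (conn_r _ u erefl) _; rewrite eC; exact: conn_r.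
have [c c_ok] : exists c : nat -> T, forall i, i < 3 -> b (c i) = i /\ h (c i) = 0.
  have [v1 b1 h1] := b_surj 1 (ltnW g_gt2).
  have [v2 b2 h2] := b_surj 2 g_gt2.
  by exists (fun i => nth r [:: r; v1; v2] i) => -[|[|[|i]]].
have [||||sz' [b' [h' [pb' dom']]]] := @dominated_by_path_blocks T R x x_gt0 d e 3 c
    (cycle_dist 3) d0 dC dD _ e_conn isT.
- by [].
- by move=> i j i3 j3 cij; have := (c_ok i i3).1; rewrite cij (c_ok j j3).1.
- exact: cycle_distC.
- move=> i j i3 j3 ij; have [bi hi] := c_ok i i3; have [bj hj] := c_ok j j3.
  rewrite /d /block_dist bi bj hi hj /kite_dist /cycle_dist /adist.
  by case: eqP => //; lia.
apply: kite_likeW dom' _; apply: kite_of_triangle pb' _ _ => //.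
  exact: cycle_distC.
by move=> i j i3 j3 ij; rewrite /cycle_dist /adist; lia.
Qed.

Variables (g : nat) (sz : nat -> nat) (b h : T -> nat).
Hypothesis bh : path_blocks g sz b h.

Let cut (k : 'I_g * bool) : T -> T -> nat :=
  block_dist kite_dist (fun u => cycle_pos g k.2 k.1 (b u)) h.

Lemma cycle_pos_bij dir k : k < g ->
  [/\ forall i, i < g -> cycle_pos g dir k i < g,
      forall i j, i < g -> j < g ->
        cycle_pos g dir k i = cycle_pos g dir k j -> i = j
    & forall p, p < g -> exists2 i, i < g & cycle_pos g dir k i = p].
Proof.
move=> kg; have pos_lt i : i < g -> cycle_pos g dir k i < g.
  move=> ig; rewrite /cycle_pos; case: (dir).
    by case: (leqP k i); lia.
  by case: (leqP i k); lia.
split=> // [i j ig jg|p pg].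
  rewrite /cycle_pos; case: (dir).
    by case: (leqP k i); case: (leqP k j); lia.
  by case: (leqP i k); case: (leqP j k); lia.
exists (if dir then (if k + p < g then k + p else k + p - g)
  else (if p <= k then k - p else k + g - p)).
  by case: (dir); [case: (ltnP (k + p) g); lia|case: (leqP p k); lia].
rewrite /cycle_pos; case: (dir).
  case: (ltnP (k + p) g) => kp; first by rewrite leq_addr; lia.
  by rewrite ifF; lia.
case: (leqP p k) => pk; first by rewrite leq_subr; lia.
by rewrite ifF; lia.
Qed.

Lemma kite_of_cut k : 2 < g -> kite_like x (cut k).
Proof.
move=> g_gt2; have [b_h _ surj_bh sz_gt0] := bh.
have [pos_lt _ pos_surj] := cycle_pos_bij k.2 (ltn_ord k.1).
apply: (kite_of_skeleton g_gt2) => [u|p pg|u l hu].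
- exact: pos_lt (b_h u).1.
- have [i ig <-] := pos_surj p pg.
  by have [u bu hu] := surj_bh i 0 ig (sz_gt0 i ig); exists u; rewrite ?bu.
- have [bu_lt hu_lt] := b_h u.
  have [|v bv hv] := surj_bh (b u) l bu_lt; first by rewrite hu in hu_lt; lia.
  by exists v; rewrite ?bv.
Qed.

Lemma cut_pair (k : 'I_g) u v :
  cut (k, true) u v + cut (k, false) u v =
  if b u == b v then 2 * adist (h u) (h v)
  else 2 * (h u + h v) + cut_dist2 g k (b u) (b v).
Proof.
have [b_h _ _ _] := bh.
rewrite /cut /block_dist; case: (eqVneq (b u) (b v)) => [->|buv].
  by rewrite !eqxx mul2n addnn.
have pos_neq dir : (cycle_pos g dir k (b u) == cycle_pos g dir k (b v)) = false.
  have [_ pos_inj _] := cycle_pos_bij dir (ltn_ord k).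
  apply: contraNF buv => /eqP/pos_inj -> //; [exact: (b_h u).1|exact: (b_h v).1].
by rewrite !pos_neq /cut_dist2 /cut_dist /=; lia.
Qed.

Lemma sum_cuts (f : 'I_g -> nat) u v :
  \sum_(k : 'I_g * bool) f k.1 * cut k u v =
  if b u == b v then (\sum_k f k) * (2 * adist (h u) (h v))
  else (\sum_k f k) * (2 * (h u + h v))
       + \sum_k f k * cut_dist2 g k (b u) (b v).
Proof.
transitivity (\sum_k f k * (cut (k, true) u v + cut (k, false) u v)).
  rewrite -(pair_bigA _ (fun k d => f k * cut (k, d) u v)) /=.
  by apply: eq_bigr => k _; rewrite big_bool mulnDr.
under eq_bigr do rewrite cut_pair.
case: eqP => _; first by rewrite big_distrl.
by rewrite big_distrl -big_split; apply: eq_bigr => k _; rewrite mulnDr.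
Qed.

Lemma sum_cut_weights (f : 'I_g -> nat) :
  \sum_(k : 'I_g * bool) f k.1 = 2 * \sum_k f k.
Proof.
rewrite -(pair_bigA _ (fun k d => f k)) /= mul2n -addnn -big_split.
by apply: eq_bigr => k _; rewrite big_bool.
Qed.

Let kite_of_lt k : 2 < g ->
  (wsum x (block_dist (cycle_dist g) b h) < wsum x (cut k))%R ->
  kite_like x (block_dist (cycle_dist g) b h).
Proof. by move=> g_gt2 lt; apply: kite_likeW (kite_of_cut k g_gt2); left. Qed.

Let block_of i : i < g -> exists u, b u = i.
Proof.
by have [_ _ surj gt0] := bh; move=> ig; have [u bu _] := surj i 0 ig (gt0 i ig); exists u.
Qed.

Lemma kite_of_odd_cycle : odd g -> 4 < g ->
  kite_like x (block_dist (cycle_dist g) b h).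
Proof.
move=> g_odd g4; have [b_h _ _ _] := bh.
(* All [2 g] cuts have weight 1. The last term on the left keeps the strict gain between adjacent
   blocks for the end of the proof. *)
have bound u v : (\sum_(k : 'I_g * bool) 1) * block_dist (cycle_dist g) b h u v
    + ((b u != b v) && (cycle_dist g (b u) (b v) == 1))
    <= \sum_(k : 'I_g * bool) 1 * cut k u v.
  rewrite (sum_cut_weights (fun=> 1)) (sum_cuts (fun=> 1)) /block_dist.
  rewrite sum1_card card_ord; case: eqP => [_|/eqP buv] /=; first by lia.
  have := odd_cut_sum g_odd g4 (b_h u).1 (b_h v).1 buv.
  under [X in _ -> _ <= _ + X]eq_bigr do rewrite mul1n.
  move: (\sum_(k < g) _) (cycle_dist _ _ _) => S s; nia.
have [|||k lt] := mixture x_gt0 (c := fun=> 1) (Di := cut)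
    (D := block_dist (cycle_dist g) b h) (E := fun _ _ => 0) (E' := fun _ _ => 0).
- by move=> u v; rewrite !addn0; apply: leq_trans (leq_addr _ _) (bound u v).
- by [].
- right; have [u bu] := @block_of 0 ltac:(lia); have [v bv] := @block_of 1 ltac:(lia).
  exists u, v; have := bound u v; rewrite bu bv !addn0.
  have -> : (0 != 1) && (cycle_dist g 0 1 == 1).
    by rewrite /cycle_dist /adist; lia.
  by move=> le; apply: leq_trans le; rewrite -addn1.
- by apply: kite_of_lt lt; lia.
Qed.

Lemma kite_of_even_cycle : ~~ odd g -> 4 < g ->
  kite_like x (block_dist (cycle_dist g) b h).
Proof.
move=> g_even g4; have [b_h _ _ _] := bh.
pose m := g./2; have gm : g = m.*2 by rewrite /m; lia.
have m2 : 2 < m by lia.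
have g_gt0 : 0 < g by lia.
pose opn i := if i < m then i + m else i - m.
have opn_lt i : i < g -> opn i < g by rewrite /opn; case: (ltnP i m); lia.
pose op (i : 'I_g) : 'I_g := Ordinal (opn_lt i (ltn_ord i)).
have opK : involutive op.
  move=> i; apply: val_inj; rewrite /= /opn; have := ltn_ord i.
  case: (ltnP i m) => im ig; first by rewrite ifF; lia.
  by rewrite ifT; lia.
have opE (i j : 'I_g) : (j == op i) = (adist i j == m).
  rewrite -(inj_eq val_inj) /= /opn /adist; have := ltn_ord i; have := ltn_ord j.
  by case: (ltnP i m); lia.
pose bo u : 'I_g := Ordinal (b_h u).1.
pose W i j := weight x (fun u => bo u == i) (fun u => bo u == j).
pose i0 : 'I_g := Ordinal g_gt0.
have [K W_max] : exists K, forall i, (W i (op i) <= W K (op K))%R.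
  exists [arg max_(i > i0) W i (op i)]%O.
  by case: (@Order.TotalTheory.arg_maxP _ _ 'I_g i0 xpredT (fun i => W i (op i))) =>
    // i _ le_i j; exact: le_i.
have opK_neq : op K != K.
  by rewrite eq_sym opE /adist; lia.
pose q (i : 'I_g) := (i == K) || (i == op K).
have adistK : adist K (op K) = m by apply/eqP; rewrite -opE.
have cnt : \sum_k (~~ q k : nat) = g - 2.
  have cntq : \sum_k (q k : nat) = 2.
    rewrite (bigD1 K) //= (bigD1 (op K)) //= /q !eqxx orbT big1 // => i.
    by move=> /andP[/negbTE-> /negbTE->].
  have : \sum_k ((~~ q k : nat) + q k) = g.
    rewrite (eq_bigr (fun=> 1)) => [|k _]; last by case: (q k).
    by rewrite sum1_card card_ord.
  by rewrite big_split /= cntq; lia.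
(* [E] is the surplus of the pairs with one end in the omitted blocks, and [E'] the loss of the
   opposite pairs outside them. *)
pose E u v := 2 * (q (bo u) (+) q (bo v)).
pose E' u v := 4 * (~~ q (bo u) && (bo v == op (bo u))).
have bound u v : (\sum_(k : 'I_g * bool) (~~ q k.1 : nat))
      * block_dist (cycle_dist g) b h u v + E u v
      + ((q (bo u) (+) q (bo v)) && (cycle_dist g (b u) (b v) == 1))
    <= \sum_(k : 'I_g * bool) ~~ q k.1 * cut k u v + E' u v.
  rewrite (sum_cut_weights (fun k => ~~ q k : nat)) (sum_cuts (fun k => ~~ q k : nat)).
  rewrite cnt /block_dist /E /E'; case: eqP => [buv|/eqP buv].
    have -> : bo u = bo v by apply: val_inj.
    by rewrite addbb /=; lia.
  have key : 2 * (g - 2) * cycle_dist g (b u) (b v) + 2 * (q (bo u) (+) q (bo v))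
        + ((q (bo u) (+) q (bo v)) && (cycle_dist g (b u) (b v) == 1))
      <= \sum_k ~~ q k * cut_dist2 g k (b u) (b v)
         + 4 * (~~ q (bo u) && (adist (b u) (b v) == m)) :=
    even_cut_sum gm m2 (ltn_ord K) (ltn_ord (op K)) adistK
      (b_h u).1 (b_h v).1 buv.
  rewrite opE; move: key; rewrite -[adist (bo u) _]/(adist (b u) (b v)).
  move: (\sum_k _) (cycle_dist _ _ _) (_ && (adist _ _ == m)) => S s anti.
  move: (q (bo u) (+) q (bo v)) => xq key.
  have -> : 2 * (g - 2) * (h u + h v + s)
      = (g - 2) * (2 * (h u + h v)) + 2 * (g - 2) * s.
    by rewrite mulnDr; congr (_ + _); rewrite -mulnA mulnCA.
  by lia.
have le_E : (wsum x E' <= wsum x E)%R.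
  exact: opposite_blocks.
have [|||k lt] := mixture x_gt0 (c := fun k => ~~ q k.1 : nat) (Di := cut)
    (D := block_dist (cycle_dist g) b h) (E := E) (E' := E').
- by move=> u v; apply: leq_trans (leq_addr _ _) (bound u v).
- exact: le_E.
(* Strictness comes from [K] and its successor on the cycle: they are adjacent and only [K] is in an
   omitted block. *)
- right; have [u bu] := block_of (ltn_ord K).
  pose j := if K.+1 == g then 0 else K.+1.
  have jg : j < g by rewrite /j; have := ltn_ord K; case: eqP; lia.
  have [v bv] := block_of jg.
  exists u, v; have := bound u v; rewrite bu bv.
  have -> : (q (bo u) (+) q (bo v)) && (cycle_dist g K j == 1).
    have -> : bo u = K by apply: val_inj; rewrite /= bu.
    have -> : q K = true by rewrite /q eqxx.
    have -> : q (bo v) = (b v == K) || (b v == op K) by [].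
    rewrite bv /=.
    have Kg := ltn_ord K; have jE : j = if K.+1 == g then 0 else K.+1 by [].
    move: adistK; rewrite /cycle_dist /adist /= jE.
    by case: (K.+1 =P g) => Kg1 adK; apply/andP; split; lia.
  by move=> le; apply: leq_trans le; rewrite -addn1.
- by apply: kite_of_lt lt; lia.
Qed.

End LongCycles.

(** * Graph distances and the distance signless Laplacian *)

Section GraphDistance.
Variables (T : finType) (e : rel T).
Hypothesis e_conn : connected_graph e.

Lemma gdist_le_walk u p : path e u p -> gdist e u (last u p) <= size p.
Proof.
move=> up; rewrite leqNgt; apply/negP => lt_p.
have p_lt : size p < #|T|.
  by apply: leq_trans lt_p _; rewrite -[X in _ <= X](size_iota 0) find_size.
have := before_find 0 lt_p; rewrite nth_iota // add0n => /existsP[].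
by exists (in_tuple p); rewrite /= up eqxx.
Qed.

Lemma gdist_walk u v : exists p,
  [/\ path e u p, last u p = v & size p = gdist e u v].
Proof.
have /connectP[p up vE] := e_conn u v.
(* A path without repetition has fewer than [#|T|] edges, so it lies in the range searched by [find]
   and the default value is not returned. *)
case/shortenP: up vE => q uq uniq_q _ vE.
have q_lt : size q < #|T|.
  by have := max_card (mem (u :: q)); rewrite (card_uniqP uniq_q).
pose P k := [exists p : k.-tuple T, path e u p && (last u p == v)].
have hasP_P : has P (iota 0 #|T|).
  apply/hasP; exists (size q); first by rewrite mem_iota.
  by apply/existsP; exists (in_tuple q); rewrite /= uq -vE eqxx.
have := nth_find 0 hasP_P; rewrite nth_iota; last first.
  by rewrite -[X in _ < X](size_iota 0) -has_find.
rewrite add0n => /existsP[t /andP[ut /eqP tE]].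
by exists t; rewrite size_tuple.
Qed.

Lemma gdist_refl u : gdist e u u = 0.
Proof.
by apply/eqP; rewrite -leqn0; have := @gdist_le_walk u [::] isT.
Qed.

Lemma gdist_triangle u v z : gdist e u z <= gdist e u v + gdist e v z.
Proof.
have [p [up pE <-]] := gdist_walk u v; have [q [vq qE <-]] := gdist_walk v z.
have := @gdist_le_walk u (p ++ q).
by rewrite cat_path up pE vq last_cat pE qE size_cat; apply.
Qed.

Lemma gdist_edge u v : e u v -> gdist e u v <= 1.
Proof. by move=> uv; have := @gdist_le_walk u [:: v]; rewrite /= uv; apply. Qed.

Lemma gdist_gt0 u v : (0 < gdist e u v) = (u != v).
Proof.
have [->|uv] := eqVneq u v; first by rewrite gdist_refl.
have [[|w p] [_ pE <-]] := gdist_walk u v => //.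
by rewrite /= in pE; rewrite pE eqxx in uv.
Qed.

Lemma gdist_eq1 u v : irreflexive e -> (gdist e u v == 1) = e u v.
Proof.
move=> e_irr; apply/eqP/idP => [uv1|uv]; last first.
  apply/eqP; rewrite eqn_leq gdist_edge // gdist_gt0.
  by apply: contraTneq uv => ->; rewrite e_irr.
have [p [up pE]] := gdist_walk u v; rewrite uv1.
by case: p up pE => [|w [|]] //= /andP[uw _] <-.
Qed.

Lemma gdist_sym u v : symmetric e -> gdist e u v = gdist e v u.
Proof.
move=> eC; wlog suff le_sym : u v / gdist e u v <= gdist e v u.
  by apply/eqP; rewrite eqn_leq !le_sym.
have [p [vp <- <-]] := gdist_walk v u.
have := @gdist_le_walk (last v p) (rev (belast v p)).
rewrite size_rev size_belast => le_rev; apply: leq_trans (le_rev _).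
  by case: p {vp le_rev} => [|w p] //=; rewrite rev_cons last_rcons.
by rewrite rev_path (eq_path (e' := e)) // => a b; rewrite eC.
Qed.

Lemma gdist_ge_lipschitz (f : T -> T -> nat) u v :
    (forall a, f a a = 0) -> (forall a b c, e b c -> f a c <= (f a b).+1) ->
  f u v <= gdist e u v.
Proof.
move=> f0 f_lip; have [p [up <- <-]] := gdist_walk u v.
elim/last_ind: p up => [|p w IHp]; first by rewrite f0.
rewrite rcons_path last_rcons size_rcons => /andP[up pw].
apply: leq_trans (f_lip _ _ _ pw) _.
exact: IHp.
Qed.

End GraphDistance.

Lemma gdist_hom (T U : finType) (e : rel T) (f : rel U) (phi : T -> U) u v :
    connected_graph e -> (forall a b, e a b -> f (phi a) (phi b)) ->
  gdist f (phi u) (phi v) <= gdist e u v.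
Proof.
move=> e_conn hom; have [p [up <- <-]] := gdist_walk e_conn u v.
have := @gdist_le_walk _ f (phi u) (map phi p).
rewrite last_map size_map; apply; rewrite path_map.
by apply: sub_path up => a b; exact: hom.
Qed.

Section QuadraticForm.
Variables (R : realType) (T : finType) (e : rel T).
Hypotheses (e_conn : connected_graph e) (eC : symmetric e) (T_gt1 : 1 < #|T|).

Let Q := dist_signless_laplacian R e.

Let QE i j : (Q i j = (transmission e (enum_val i))%:R *+ (i == j)
  + (gdist e (enum_val i) (enum_val j))%:R)%R.
Proof. by rewrite /Q !mxE. Qed.

Lemma wsum_qform (x : T -> R) (y : 'rV[R]_#|T|) :
  (forall u, y ord0 (enum_rank u) = x u) -> (wsum x (gdist e) = qform Q y *+ 2)%R.
Proof.
move=> yx; rewrite /qform (reindex (@enum_rank T)) /=; last first.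
  exact/onW_bij/enum_rank_bij.
pose S1 : R := (\sum_u \sum_v (gdist e u v)%:R * x u ^+ 2)%R.
pose S2 : R := (\sum_u \sum_v (gdist e u v)%:R * (x u * x v))%R.
have -> : (\sum_u \sum_j Q (enum_rank u) j * (y ord0 (enum_rank u) * y ord0 j)
    = S1 + S2)%R.
  rewrite /S1 /S2 -big_split; apply: eq_bigr => u _ /=.
  rewrite (reindex (@enum_rank T)) /=; last exact/onW_bij/enum_rank_bij.
  rewrite -mulr_suml -natr_sum -/(transmission e u).
  transitivity (\sum_v ((transmission e u)%:R *+ (u == v) * (x u * x v)
      + (gdist e u v)%:R * (x u * x v)))%R.
    apply: eq_bigr => v _.
    by rewrite QE !enum_rankK !yx (inj_eq enum_rank_inj) mulrDl.
  rewrite big_split /=; congr (_ + _)%R; rewrite (bigD1 u) //= eqxx big1.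
    by rewrite addr0 expr2.
  by move=> v; rewrite eq_sym => /negbTE->; rewrite mulr0n mul0r.
have S1' : (S1 = \sum_u \sum_v (gdist e u v)%:R * x v ^+ 2)%R.
  rewrite /S1 exchange_big; apply: eq_bigr => u _; apply: eq_bigr => v _.
  by rewrite (gdist_sym e_conn).
have -> : ((S1 + S2) *+ 2 = S1 + S1 + S2 *+ 2)%R by ring.
rewrite {2}S1' /S1 /S2 /wsum -sumrMnl -!big_split; apply: eq_bigr => u _ /=.
by rewrite -sumrMnl -!big_split; apply: eq_bigr => v _ /=; ring.
Qed.

Let sqnormE (x : T -> R) (y : 'rV[R]_#|T|) :
  (forall u, y ord0 (enum_rank u) = x u) -> (sqnorm y = \sum_u x u ^+ 2)%R.
Proof.
move=> yx; rewrite /sqnorm (reindex (@enum_rank T)) /=; last first.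
  exact/onW_bij/enum_rank_bij.
by apply: eq_bigr => u _; rewrite yx.
Qed.

Lemma dQ1_perron :
  (exists2 x : T -> R, (forall u, 0 < x u)%R &
     wsum x (gdist e) = dQ1 R e * (\sum_u x u ^+ 2) *+ 2)%R /\
  (forall x : T -> R, wsum x (gdist e) <= dQ1 R e * (\sum_u x u ^+ 2) *+ 2)%R.
Proof.
have [u0 _] : exists u : T, u \in T by apply/card_gt0P; exact: ltnW.
have Q_sym i j : Q i j = Q j i.
  rewrite !QE (gdist_sym e_conn) // eq_sym.
  by case: eqP => [->|].
have Q_gt0 i j : (0 < Q i j)%R.
  rewrite QE; have [<-|ij] := eqVneq i j; last first.
    by rewrite mulr0n add0r ltr0n gdist_gt0 // (inj_eq enum_val_inj).
  (* The diagonal entries are transmissions, positive because there is a second vertex. *)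
  rewrite gdist_refl addr0 mulr1n ltr0n lt0n; apply/negP.
  rewrite sum_nat_eq0 => /forallP all0.
  have [v vi] : exists v, v != enum_val i.
    by have /card_gt1P[a [b [_ _ ab]]] := T_gt1; case: (eqVneq a (enum_val i)) => [<-|];
      [exists b; rewrite eq_sym|exists a].
  by have := all0 v; rewrite /= -leqn0 leqNgt gdist_gt0 // eq_sym vi.
have [y y_gt0 [y_eq y_max]] := perron (enum_rank u0) Q_sym Q_gt0.
split.
  exists (fun u => y ord0 (enum_rank u)) => [u|]; first exact: y_gt0.
  by rewrite (@wsum_qform _ y) // y_eq (@sqnormE (fun u => y ord0 (enum_rank u)) y).
move=> x; pose z : 'rV[R]_#|T| := (\row_i x (enum_val i))%R.
have zx u : z ord0 (enum_rank u) = x u by rewrite mxE enum_rankK.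
by rewrite (wsum_qform zx) lerMn2r /= -(sqnormE zx) y_max.
Qed.

(** The vector [x] transported by the inverse bijection is a test vector for the Rayleigh quotient
    on [T]. *)
Lemma wsum_le_dQ1 (U : finType) (phi : U -> T) (x : U -> R) : bijective phi ->
  (wsum x (fun u v => gdist e (phi u) (phi v))
   <= dQ1 R e * (\sum_u x u ^+ 2) *+ 2)%R.
Proof.
move=> [psi phiK psiK]; have [_ /(_ (x \o psi))] := dQ1_perron.
rewrite (reindex phi) /=; last by exists psi => ? _.
under eq_bigr do rewrite phiK.
congr (_ <= _)%R; rewrite /wsum (reindex phi) /=; last by exists psi => ? _.
apply: eq_bigr => u _; rewrite (reindex phi) /=; last by exists psi => ? _.
by apply: eq_bigr => v _; rewrite !phiK.
Qed.

End QuadraticForm.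

Lemma gdist_cycle (T : finType) (e : rel T) (s : seq T) (u0 : T) i j :
    connected_graph e -> symmetric e -> cycle e s -> i < size s -> j < size s ->
  gdist e (nth u0 s i) (nth u0 s j) <= cycle_dist (size s) i j.
Proof.
move=> e_conn eC cyc.
wlog ij : i j / i <= j.
  move=> wl ig jg; have [ij|/ltnW ji] := leqP i j; first exact: wl.
  by rewrite gdist_sym // cycle_distC; exact: wl.
case: s cyc => // a p cyc ig jg; set s := a :: p in cyc ig jg *.
have edge k : k.+1 < size s -> e (nth u0 s k) (nth u0 s k.+1).
  move=> k_lt; have /(pathP u0)/(_ k) := cyc.
  rewrite size_rcons => /(_ (ltnW k_lt)).
  by rewrite nth_rcons [in X in e X _]/= -rcons_cons nth_rcons -/s (ltnW k_lt)
    (_ : k < size p).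
have closing : e (nth u0 s (size p)) (nth u0 s 0).
  have /(pathP u0)/(_ (size p)) := cyc; rewrite size_rcons ltnSn => /(_ isT).
  by rewrite -rcons_cons !nth_rcons ltnn eqxx /= ltnSn.
have along k l : k + l < size s ->
    gdist e (nth u0 s k) (nth u0 s (k + l)) <= l.
  elim: l => [|l IHl] kl; first by rewrite addn0 gdist_refl.
  have := gdist_triangle e_conn (nth u0 s k) (nth u0 s (k + l)) (nth u0 s (k + l.+1)).
  have := gdist_edge (edge (k + l) _); rewrite -addnS => /(_ kl).
  by have := IHl (ltnW _); rewrite addnS in kl *; move=> /(_ kl); lia.
have -> : cycle_dist (size s) i j = minn (j - i) (size s - (j - i)).
  by rewrite /cycle_dist /adist; lia.
rewrite leq_min; apply/andP; split.
  by have := along i (j - i); rewrite subnKC //; apply.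
have := along 0 i; rewrite add0n => /(_ ig) d0i.
have := along j (size p - j); rewrite subnKC //= => /(_ (ltnSn _)) djp.
have dp0 := gdist_edge closing.
have := gdist_triangle e_conn (nth u0 s j) (nth u0 s (size p)) (nth u0 s 0).
have := gdist_triangle e_conn (nth u0 s j) (nth u0 s 0) (nth u0 s i).
rewrite (gdist_sym e_conn (nth u0 s i)) //.
by have sz_s : size s = (size p).+1 by []; rewrite sz_s in jg *; lia.
Qed.

Lemma unicyclic_kite_like (R : realFieldType) (T : finType) (e : rel T)
    (x : T -> R) :
    (forall u, 0 < x u)%R -> 5 < #|T| -> symmetric e -> unicyclic e ->
  kite_like x (gdist e).
Proof.
move=> x_gt0 T6 eC [e_conn [C [[s [s_gt2 /andP[cyc uniq_s] _]] _]]].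
have [u0 _] : exists u : T, u \in T by apply/card_gt0P; exact: leq_ltn_trans T6.
have [|||sz [b [h [pb dom]]]] := @dominated_by_path_blocks T R x x_gt0 (gdist e) e
    (size s) (nth u0 s) (cycle_dist (size s)) (gdist_refl e)
    (fun u v => gdist_sym e_conn u v eC) (gdist_triangle e_conn) (@gdist_edge T e)
    e_conn (ltnW s_gt2).
- by move=> i j ig jg /eqP; rewrite nth_uniq // => /eqP.
- exact: cycle_distC.
- by move=> i j ig jg _; exact: gdist_cycle.
apply: kite_likeW dom _.
have [g_gt4|] := ltnP 4 (size s).
  have [g_odd|g_even] := boolP (odd (size s)).
    exact: kite_of_odd_cycle pb g_odd g_gt4.
  exact: kite_of_even_cycle pb g_even g_gt4.
case: (size s) s_gt2 pb => [|[|[|[|[|]]]]] // _ pb _.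
  apply: kite_of_triangle pb _ _ => // [i j|i j i3 j3 ij].
    exact: cycle_distC.
  by rewrite /cycle_dist /adist; lia.
exact: kite_of_4cycle pb T6.
Qed.

(** * Distances in the kite *)

Section Kite.
Variable n : nat.
Let K := kite3 (n := n).

Lemma kite3_sym : symmetric K.
Proof. by move=> i j; rewrite /K /kite3 orbC. Qed.

Lemma kite3E i j : K i j = (kite_dist i j == 1).
Proof. by rewrite /K /kite3 /kite3_arc /kite_dist /adist; lia. Qed.

Lemma kite3_connected : connected_graph K.
Proof.
rewrite /K; case: n => [|m]; first by case.
have conn0 i (im : i < m.+1) : connect (kite3 (n := m.+1)) (Ordinal im) ord0.
  elim: i im => [|i IHi] im.
    by rewrite (_ : Ordinal im = ord0) ?connect0 //; apply: val_inj.
  apply: connect_trans (connect1 _) (IHi (ltnW im)).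
  by rewrite /kite3 /kite3_arc /=; lia.
have KC : connect_sym (kite3 (n := m.+1)).
  by apply: sym_connect_sym => i j; rewrite /kite3 orbC.
move=> [i im] [j jm]; apply: connect_trans (conn0 i im) _.
by rewrite KC; exact: conn0.
Qed.

(** This direction carries the final bound over to the kite. It holds because the triangle
    inequality lets [kite_dist] grow by at most 1 along an edge. *)
Lemma kite_dist_le_gdist (i j : 'I_n) : kite_dist i j <= gdist K i j.
Proof.
apply: (gdist_ge_lipschitz kite3_connected (f := fun i j => kite_dist i j)).
  by move=> k; rewrite /kite_dist /adist; lia.
move=> a b c; rewrite kite3E => /eqP bc.
by have := kite_dist_triangle a b c; lia.
Qed.

End Kite.

(** The Perron vector of [f], carried to [T], tests the quotient of [e]. Applied to an isomorphism
    and to its inverse, this gives the invariance of the eigenvalue. *)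
Lemma dQ1_le_hom (R : realType) (T U : finType) (e : rel T) (f : rel U)
    (phi : T -> U) :
    connected_graph e -> connected_graph f -> symmetric e -> symmetric f ->
    1 < #|T| -> bijective phi -> (forall a b, e a b = f (phi a) (phi b)) ->
  (dQ1 R f <= dQ1 R e)%R.
Proof.
move=> e_conn f_conn eC fC T_gt1 phi_bij hom.
have [psi phiK psiK] := phi_bij.
have U_gt1 : 1 < #|U| by rewrite -(bij_eq_card phi_bij).
have [[x x_gt0 x_eq] _] := dQ1_perron R f_conn fC U_gt1.
have x2_gt0 : (0 < \sum_u x u ^+ 2)%R.
  have [u0 _] : exists u : U, u \in U by apply/card_gt0P; exact: ltnW.
  rewrite (bigD1 u0) //= ltr_pwDl ?exprn_gt0 ?x_gt0 //.
  by apply: sumr_ge0 => u _; rewrite sqr_ge0.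
have psi_bij : bijective psi by exists phi.
have := wsum_le_dQ1 e_conn eC T_gt1 x psi_bij.
have : (wsum x (gdist f) <= wsum x (fun u v => gdist e (psi u) (psi v)))%R.
  apply: wsum_le => // u v; rewrite -{1}[u]psiK -{1}[v]psiK.
  by apply: gdist_hom => // a b; rewrite hom.
rewrite x_eq => le1 le2; have := le_trans le1 le2.
by rewrite lerMn2r /= ler_pM2r.
Qed.

(** * Comparison with the kite and the equality case *)

Local Open Scope ring_scope.

Theorem theorem7p6 (R : realType) (n : nat) (hn : (6 <= n)%N)
    (T : finType) (hT : #|T| = n)
    (e : rel T) (he : simple_graph e) (hu : unicyclic e) :
  dQ1 R e <= dQ1 R (kite3 (n := n)) /\
  (dQ1 R e = dQ1 R (kite3 (n := n)) <-> graph_iso e (kite3 (n := n))).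
Proof.
have [eC e_irr] := he; have [e_conn _] := hu.
have T_gt1 : (1 < #|T|)%N by rewrite hT; lia.
have I_gt1 : (1 < #|'I_n|)%N by rewrite card_ord; lia.
have K_conn := @kite3_connected n; have K_sym := @kite3_sym n.
have [[x x_gt0 x_eq] _] := dQ1_perron R e_conn eC T_gt1.
have x2_gt0 : 0 < \sum_u x u ^+ 2.
  have [u0 _] : exists u : T, u \in T by apply/card_gt0P; exact: ltnW.
  rewrite (bigD1 u0) //= ltr_pwDl ?exprn_gt0 ?x_gt0 //.
  by apply: sumr_ge0 => u _; rewrite sqr_ge0.
have [p [p_inj p_lt dom]] : kite_like x (gdist e).
  by apply: unicyclic_kite_like; rewrite ?hT.
have p_ltn u : (p u < n)%N by rewrite -hT.
pose phi u : 'I_n := Ordinal (p_ltn u).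
have phi_bij : bijective phi.
  apply: inj_card_bij; last by rewrite card_ord hT.
  by move=> u v /(congr1 val); exact: p_inj.
have le_K : wsum x (fun u v => kite_dist (p u) (p v))
    <= dQ1 R (kite3 (n := n)) * (\sum_u x u ^+ 2) *+ 2.
  apply: le_trans (wsum_le_dQ1 K_conn K_sym I_gt1 x phi_bij).
  by apply: wsum_le => // u v; exact: kite_dist_le_gdist (phi u) (phi v).
have kite_iso : graph_iso e (kite3 (n := n)) ->
    dQ1 R e = dQ1 R (kite3 (n := n)).
  case=> psi psi_bij psi_hom; apply/eqP; rewrite eq_le; apply/andP; split.
    have [chi psiK chiK] := psi_bij.
    apply: (@dQ1_le_hom R _ _ _ _ chi) => //; first by exists psi.
    by move=> i j; rewrite psi_hom !chiK.
  exact: (@dQ1_le_hom R _ _ _ _ psi).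
(* A strict increase makes the eigenvalues differ, which also excludes an isomorphism. Otherwise
   [phi] identifies the distances of the graph with [kite_dist], and comparing the pairs at distance
   one shows that it is an isomorphism. *)
case: dom => [lt_K|eq_K].
  have lt_dQ : dQ1 R e < dQ1 R (kite3 (n := n)).
    have := lt_le_trans lt_K le_K; rewrite x_eq ltrMn2r /=.
    by rewrite ltr_pM2r.
  split; first exact: ltW.
  by split=> // eq_dQ; move: lt_dQ; rewrite eq_dQ ltxx.
have iso : graph_iso e (kite3 (n := n)).
  exists phi => // u v; rewrite kite3E -(gdist_eq1 e_conn) //.
  by rewrite eq_K.
by split; [rewrite kite_iso|split].
Qed.
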